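(* Let $s,t,u,v\in\mathbb R^\times$, $\lambda,\varepsilon\in\mathbb R$, $\alpha=(s,u,t,v,\lambda,\varepsilon)$, and $x,y\in\mathbb C^\times$ (such that both sides are defined). The overlap coefficient $\Phi(x,y)=\Phi_\alpha(x,y)$ can be expressed as an Askey-Wilson function by $$\Phi(x,y)=\frac{(b^\vartheta y^{\pm1};q^2)_\infty\,\theta(1/\kappa,ad\kappa;q^2)}{(q^2,q^2y^{\pm1}/d^\vartheta;q^2)_\infty}\,\psi_y(x;a,b,c,d\,|\,q^2),$$ where $(a,b,c,d,\kappa)=(sq^{1-2i\lambda},sq^{1+2i\lambda},tvq/u,qv/ut,q^{-1-2\varepsilon+2i\lambda})$, $b^\vartheta=tq^{1+2i\lambda}$ and $d^\vartheta=uq/vs$.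
   Context: Fix $q\in(0,1)$. $(x;q)_\infty=\prod_{k\ge0}(1-xq^k)$, $\theta(x;q)=(x;q)_\infty(q/x;q)_\infty$; several arguments mean products, and $\pm$ in exponents means the product over all sign choices. ${}_4\varphi_3$ is the standard basic hypergeometric series. For $\alpha=(s,u,t,v,\lambda,\varepsilon)$ let $\alpha^\vartheta=(t,v,s,u,\lambda,-\varepsilon)$, $\bar\alpha=(\bar s,\bar u,\bar t,\bar v,\lambda,\varepsilon)$, and $$f_{x,\alpha}(z)=\frac{(sq^{1-2i\lambda}x^{\pm1},uszq^{1+i\lambda};q^2)_\infty\,\theta(q^{2\varepsilon-i\lambda}uz/s;q^2)}{(uzq^{-i\lambda}x^{\pm1},sq^{1-i\lambda}/uz;q^2)_\infty}.$$ Let $\langle f,g\rangle=\frac1{2\pi i}\int_{\mathbb T}f(z)\overline{g(\bar z^{-1})}\frac{dz}z$, with $\mathbb T$ the positively oriented unit circle. For $0<|ux|,|u/x|,|vy|,|v/y|\le q^2$ and $0<|s/u|,|t/v|\le q$, $\Phi_\alpha(x,y)=\langle f_{x,\alpha},g\rangle$ with $g(z)=f_{\bar y,\bar\alpha^\vartheta}(1/z)$; explicitly, $$\Phi_\alpha(x,y)=(sq^{1-2i\lambda}x^{\pm1},tq^{1+2i\lambda}y^{\pm1};q^2)_\infty\frac1{2\pi i}\int_{\mathcal C}\frac{(uszq^{1+i\lambda},tvzq^{1-i\lambda};q^2)_\infty\,\theta(uzq^{2\varepsilon-i\lambda}/s,vzq^{-2\varepsilon+i\lambda}/t;q^2)}{(uzq^{-i\lambda}x^{\pm1},sq^{1-i\lambda}/uz,vzq^{i\lambda}y^{\pm1},tq^{1+i\lambda}/vz;q^2)_\infty}\frac{dz}z$$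 with $\mathcal C=\mathbb T$; for other parameter values the same formula is used with $\mathcal C$ a deformation of $\mathbb T$ having the points $u^{-1}sq^{1-i\lambda}q^{2k}$, $v^{-1}tq^{1+i\lambda}q^{2k}$ ($k\in\mathbb Z_{\ge0}$) inside and $u^{-1}q^{i\lambda}x^{\pm1}q^{-2k}$, $v^{-1}q^{-i\lambda}y^{\pm1}q^{-2k}$ outside. Askey-Wilson function: for parameters $A,B,C,D$ with $A=\overline B$ and $C,D\in\mathbb R$, dual parameters in base $q$ are $\widetilde A=\sqrt{ABCD/q}$, $\widetilde B=AB/\widetilde A$, $\widetilde C=AC/\widetilde A$, $\widetilde D=AD/\widetilde A$, and $$\psi_\gamma(x;A,B,C,D|q)=\frac{(AB,AC;q)_\infty}{(q/AD;q)_\infty}\,{}_4\varphi_3\!\left({Ax,A/x,\widetilde A\gamma,\widetilde A/\gamma\atop AB,AC,AD};q,q\right)+\frac{(Ax^{\pm1},\widetilde A\gamma^{\pm1},qB/D,qC/D;q)_\infty}{(qx^{\pm1}/D,q\gamma^{\pm1}/\widetilde D,AD/q;q)_\infty}\,{}_4\varphi_3\!\left({qx/D,q/Dx,q\gamma/\widetilde D,q/\widetilde D\gamma\atop qB/D,qC/D,q^2/AD};q,q\right).$$ In the claim, base $q$ is replaced by $q^2$ in this definition (so $\widetilde A=\sqrt{abcd/q^2}$), and the square root is taken to be $\widetilde A=svq/u=q^2/d^\vartheta$. *)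

(* Defs.v *)
From Stdlib Require Import Reals Lra List.
From Coquelicot Require Import Coquelicot.
Import ListNotations.

Open Scope C_scope.

(** Total limit operator: the usual limit whenever the sequence converges in
    [C] (real and imaginary parts are treated separately). *)
Definition Clim_seq (w : nat -> C) : C :=
  (real (Lim_seq (fun n => Re (w n))), real (Lim_seq (fun n => Im (w n)))).

Definition Cseries (w : nat -> C) : C := Clim_seq (fun n => sum_n w n).

Fixpoint qpoch_n (a : C) (p : R) (n : nat) : C :=
  match n with
  | O => 1
  | S k => qpoch_n a p k * (1 - a * (p ^ k)%R)
  end.

Definition qpoch (a : C) (p : R) : C := Clim_seq (qpoch_n a p).

Definition theta1 (a : C) (p : R) : C := qpoch a p * qpoch (p / a) p.

Definition Cprod (l : list C) : C := fold_right Cmult 1 l.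

Definition qpochs_n (p : R) (l : list C) (n : nat) : C :=
  Cprod (map (fun a => qpoch_n a p n) l).

Definition qpochs (p : R) (l : list C) : C :=
  Cprod (map (fun a => qpoch a p) l).

Definition thetas (p : R) (l : list C) : C :=
  Cprod (map (fun a => theta1 a p) l).

Definition phi43 (a1 a2 a3 a4 b1 b2 b3 : C) (p : R) (z : C) : C :=
  Cseries (fun n => qpochs_n p [a1; a2; a3; a4] n
                    / qpochs_n p [RtoC p; b1; b2; b3] n * z ^ n).

Definition phi43_defined (b1 b2 b3 : C) (p : R) : Prop :=
  forall n : nat, qpochs_n p [b1; b2; b3] n <> 0.

(** Complex powers of a positive real base, with the principal logarithm. *)
Definition Cexp (w : C) : C :=
  ((exp (Re w) * cos (Im w))%R, (exp (Re w) * sin (Im w))%R).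

Definition qpow (q : R) (w : C) : C := Cexp (ln q * w).

(** Closed C^1 curves, parametrised by [0,1].  The derivative is allowed to
    vanish, so piecewise C^1 closed curves are covered up to
    reparametrisation.  Differentiability is two-sided at 0 and 1, which only
    means that the path is extended outside [0,1]. *)
Record contour := Contour {
  path :> R -> C;
  path' : R -> C;
  path_derive : forall r : R, (0 <= r <= 1)%R ->
    is_derive (K := R_AbsRing) (V := C_R_NormedModule) path r (path' r);
  path'_continuous : forall r : R, (0 <= r <= 1)%R ->
    continuous (T := R_UniformSpace) (U := C_UniformSpace) path' r;
  path_closed : path 0 = path 1
}.

Definition contour_int (F : C -> C) (g : contour) : C :=
  RInt (V := C_R_CompleteNormedModule) (fun r => F (g r) * path' g r) 0 1.

Definition winding (g : contour) (w : C) : C :=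
  / (2 * PI * Ci) * contour_int (fun z => / (z - w)) g.

Definition avoids (g : contour) (w : C) : Prop :=
  forall r : R, (0 <= r <= 1)%R -> g r <> w.

Definition inside (g : contour) (w : C) : Prop := avoids g w /\ winding g w = 1.

Definition outside (g : contour) (w : C) : Prop := avoids g w /\ winding g w = 0.

(** Free homotopy, through closed curves in the punctured plane, from the
    positively oriented unit circle. *)
Definition deformation_of_circle (g : contour) : Prop :=
  exists H : R -> R -> C,
    (forall a r : R, (0 <= a <= 1)%R -> (0 <= r <= 1)%R ->
       continuous (T := prod_UniformSpace R_UniformSpace R_UniformSpace)
         (U := C_UniformSpace) (fun ar => H (fst ar) (snd ar)) (a, r)
       /\ H a r <> 0) /\
    (forall a : R, (0 <= a <= 1)%R -> H a 0%R = H a 1%R) /\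
    (forall r : R, (0 <= r <= 1)%R ->
       H 0%R r = Cexp (2 * PI * Ci * r) /\ H 1%R r = g r).

Record params := Params {
  ps : C; pu : C; pt : C; pv : C; plam : R; peps : R
}.

Definition vartheta (al : params) : params :=
  Params (pt al) (pv al) (ps al) (pu al) (plam al) (- peps al).

Definition bar (al : params) : params :=
  Params (Cconj (ps al)) (Cconj (pu al)) (Cconj (pt al)) (Cconj (pv al))
    (plam al) (peps al).

Definition ffun (q : R) (x : C) (al : params) (z : C) : C :=
  let p := (q ^ 2)%R in
  let s := ps al in let u := pu al in
  let il := Ci * plam al in let eps := peps al in
  qpochs p [s * qpow q (1 - 2 * il) * x; s * qpow q (1 - 2 * il) / x;
            u * s * z * qpow q (1 + il)]
  * thetas p [qpow q (2 * eps - il) * u * z / s]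
  / qpochs p [u * z * qpow q (- il) * x; u * z * qpow q (- il) / x;
              s * qpow q (1 - il) / (u * z)].

Definition Phi_factor (q : R) (al : params) (x y : C) : C :=
  let il := Ci * plam al in
  qpochs (q ^ 2)
    [ps al * qpow q (1 - 2 * il) * x; ps al * qpow q (1 - 2 * il) / x;
     pt al * qpow q (1 + 2 * il) * y; pt al * qpow q (1 + 2 * il) / y].

Definition Phi_kernel (q : R) (al : params) (x y z : C) : C :=
  let p := (q ^ 2)%R in
  let s := ps al in let u := pu al in let t := pt al in let v := pv al in
  let il := Ci * plam al in let eps := peps al in
  qpochs p [u * s * z * qpow q (1 + il); t * v * z * qpow q (1 - il)]
  * thetas p [u * z * qpow q (2 * eps - il) / s;
              v * z * qpow q (- (2 * eps) + il) / t]
  / qpochs p [u * z * qpow q (- il) * x; u * z * qpow q (- il) / x;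
              s * qpow q (1 - il) / (u * z);
              v * z * qpow q il * y; v * z * qpow q il / y;
              t * qpow q (1 + il) / (v * z)].

(** The value of the overlap coefficient computed along the contour [g]; it is
    the overlap coefficient as soon as [g] is [Phi_admissible]. *)
Definition Phi (q : R) (al : params) (x y : C) (g : contour) : C :=
  Phi_factor q al x y
  * (/ (2 * PI * Ci) * contour_int (fun z => Phi_kernel q al x y z / z) g).

(** For [0 < |ux|, |u/x|, |vy|, |v/y| <= q^2] and [0 < |s/u|, |t/v| <= q] the
    unit circle itself satisfies these conditions. *)
Definition Phi_admissible (q : R) (al : params) (x y : C) (g : contour) : Prop :=
  let s := ps al in let u := pu al in let t := pt al in let v := pv al in
  let il := Ci * plam al in
  deformation_of_circle g /\
  forall k : nat,
    let pk := RtoC (q ^ (2 * k)) in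
    inside g (/ u * s * qpow q (1 - il) * pk) /\
    inside g (/ v * t * qpow q (1 + il) * pk) /\
    outside g (/ u * qpow q il * x / pk) /\
    outside g (/ u * qpow q il / x / pk) /\
    outside g (/ v * qpow q (- il) * y / pk) /\
    outside g (/ v * qpow q (- il) / y / pk).

(** [psi p At gam x a b c d] is [psi_gam(x; a,b,c,d | p)]; [At] is the chosen
    square root of [a b c d / p]. *)
Definition psi (p : R) (At gam x a b c d : C) : C :=
  let Dt := a * d / At in
  qpochs p [a * b; a * c] / qpochs p [p / (a * d)]
  * phi43 (a * x) (a / x) (At * gam) (At / gam) (a * b) (a * c) (a * d) p p
  + qpochs p [a * x; a / x; At * gam; At / gam; p * b / d; p * c / d]
    / qpochs p [p * x / d; p / (x * d); p * gam / Dt; p / (gam * Dt); a * d / p]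
    * phi43 (p * x / d) (p / (d * x)) (p * gam / Dt) (p / (Dt * gam))
        (p * b / d) (p * c / d) (p ^ 2 / (a * d)) p p.

(** No denominator in the definition of [psi] vanishes. *)
Definition psi_defined (p : R) (At gam x a b c d : C) : Prop :=
  let Dt := a * d / At in
  qpochs p [p / (a * d)] <> 0 /\
  phi43_defined (a * b) (a * c) (a * d) p /\
  qpochs p [p * x / d; p / (x * d); p * gam / Dt; p / (gam * Dt); a * d / p]
    <> 0 /\
  phi43_defined (p * b / d) (p * c / d) (p ^ 2 / (a * d)) p.

Lemma Clim_seq_conj (w w' : nat -> C) :
  (forall n, w' n = Cconj (w n)) -> Clim_seq w' = Cconj (Clim_seq w).
Proof.
  intros E; unfold Clim_seq, Cconj; simpl; f_equal.
  - f_equal; apply Lim_seq_ext; intros n; now rewrite E, re_conj.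
  - rewrite (Lim_seq_ext _ (fun n => (- Im (w n))%R)).
    + rewrite Lim_seq_opp; now destruct (Lim_seq (fun n => Im (w n))); simpl;
        rewrite ?Ropp_0.
    + intros n; now rewrite E, im_conj.
Qed.

Lemma RtoC_conj (r : R) : Cconj r = r.
Proof. unfold Cconj, RtoC; simpl; now rewrite Ropp_0. Qed.

Lemma Cconj_inv (a : C) : Cconj (/ a) = / Cconj a.
Proof.
  unfold Cinv, Cconj; simpl.
  replace (- snd a * (- snd a * 1))%R with (snd a * (snd a * 1))%R by ring.
  f_equal; unfold Rdiv; ring.
Qed.

Lemma Cconj_div (a b : C) : Cconj (a / b) = Cconj a / Cconj b.
Proof. unfold Cdiv; now rewrite Cmult_conj, Cconj_inv. Qed.

Lemma qpoch_conj (a : C) (p : R) : qpoch (Cconj a) p = Cconj (qpoch a p).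
Proof.
  apply Clim_seq_conj; intros n; induction n as [|n IH]; cbn [qpoch_n].
  - now rewrite RtoC_conj.
  - now rewrite IH, Cmult_conj, Cminus_conj, Cmult_conj, !RtoC_conj.
Qed.

Lemma qpow_conj (q : R) (w : C) : qpow q (Cconj w) = Cconj (qpow q w).
Proof.
  unfold qpow, Cexp.
  assert (E : ln q * Cconj w = Cconj (ln q * w))
    by now rewrite Cmult_conj, RtoC_conj.
  rewrite E, re_conj, im_conj, cos_neg, sin_neg; unfold Cconj; simpl.
  f_equal; ring.
Qed.

Lemma Cconj_Ci (r : R) : Cconj (Ci * r) = - (Ci * r).
Proof. unfold Cconj, Ci, RtoC, Cmult, Copp; simpl; f_equal; ring. Qed.

Lemma Cinv_mult (a b : C) : / (a * b) = / a * / b.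
Proof.
  assert (E0 : / (0 : C) = 0)
    by (unfold Cinv, RtoC; simpl; f_equal; unfold Rdiv; ring).
  destruct (Ceq_dec a 0) as [->|Ha].
  { now rewrite Cmult_0_l, E0, Cmult_0_l. }
  destruct (Ceq_dec b 0) as [->|Hb].
  { now rewrite Cmult_0_r, E0, Cmult_0_r. }
  field; split; assumption.
Qed.

(** The integrand of [Phi] is [f_{x,alpha}(z) * conj (g (1 / conj z))] with
    [g(z) = f_{conj y, bar (vartheta alpha)}(1/z)]. *)
Lemma Phi_pairing (q : R) (al : params) (x y z : C) : z <> 0 ->
  let g := fun w => ffun q (Cconj y) (bar (vartheta al)) (/ w) in
  ffun q x al z * Cconj (g (/ Cconj z))
  = Phi_factor q al x y * Phi_kernel q al x y z.
Proof.
  intros Hz g; unfold g, ffun, Phi_factor, Phi_kernel.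
  assert (Ez : / / Cconj z = Cconj z).
  { rewrite <- !Cconj_inv; f_equal; field; exact Hz. }
  rewrite Ez; cbn [bar vartheta ps pu pt pv plam peps].
  set (il := Ci * plam al).
  assert (Eil : Cconj il = - il) by apply Cconj_Ci.
  unfold qpochs, thetas, theta1; cbn [map Cprod fold_right].
  repeat first [rewrite Cconj_div | rewrite Cmult_conj | rewrite Cconj_conj
    | rewrite Cplus_conj | rewrite Cminus_conj | rewrite Copp_conj
    | rewrite RtoC_conj | rewrite Eil | rewrite <- qpoch_conj
    | rewrite <- qpow_conj].
  assert (E1 : 1 - 2 * - il = 1 + 2 * il) by ring.
  assert (E2 : 1 + - il = 1 - il) by ring.
  assert (E3 : 2 * (- peps al)%R - - il = - (2 * peps al) + il)
    by (rewrite RtoC_opp; ring).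
  assert (E4 : - - il = il) by ring.
  assert (E5 : 1 - - il = 1 + il) by ring.
  rewrite E1, E2, E3, E4, E5, (Cmult_comm (pv al) (pt al)).
  replace (qpow q (2 * peps al - il) * pu al * z)
    with (pu al * z * qpow q (2 * peps al - il)) by ring.
  replace (qpow q (- (2 * peps al) + il) * pv al * z)
    with (pv al * z * qpow q (- (2 * peps al) + il)) by ring.
  rewrite !Cmult_1_r.
  repeat match goal with |- context [qpoch ?a ?r] => generalize (qpoch a r) end.
  intros; unfold Cdiv; rewrite !Cinv_mult; ring.
Qed.

Lemma qpow_plus (q : R) (w w' : C) : qpow q (w + w') = qpow q w * qpow q w'.
Proof.
  unfold qpow; rewrite Cmult_plus_distr_l; unfold Cexp.
  rewrite re_plus, im_plus, exp_plus, cos_plus, sin_plus.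
  apply injective_projections; simpl; ring.
Qed.

Lemma qpow_1 (q : R) : (0 < q)%R -> qpow q 1 = q.
Proof.
  intros Hq; unfold qpow; rewrite Cmult_1_r; unfold Cexp, RtoC; simpl.
  now rewrite cos_0, sin_0, exp_ln, Rmult_1_r, Rmult_0_r.
Qed.

(** The square root used for [psi] in the expansion of [Phi]. *)
Lemma At_sqr (q s t u v lam : R) :
  (0 < q)%R -> t <> 0%R -> u <> 0%R ->
  let il := Ci * lam in
  RtoC (s * v * q / u) * RtoC (s * v * q / u)
  = (s * qpow q (1 - 2 * il)) * (s * qpow q (1 + 2 * il))
    * RtoC (t * v * q / u) * RtoC (q * v / (u * t)) / RtoC (q ^ 2).
Proof.
  intros Hq Ht Hu il.
  assert (E : qpow q (1 - 2 * il) * qpow q (1 + 2 * il) = RtoC (q * q)).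
  { rewrite <- qpow_plus.
    replace (1 - 2 * il + (1 + 2 * il)) with (1 + 1) by ring.
    now rewrite qpow_plus, qpow_1, RtoC_mult. }
  transitivity ((s * s) * RtoC (q * q) * RtoC (t * v * q / u)
    * RtoC (q * v / (u * t)) / RtoC (q ^ 2)).
  - unfold Cdiv; rewrite <- RtoC_inv by (apply pow_nonzero; lra).
    rewrite <- !RtoC_mult; f_equal; field; lra.
  - rewrite <- E; unfold Cdiv; ring.
Qed.

(* Main.v *)
Require Import Defs.
From Stdlib Require Import Reals Lra Lia List.
From Coquelicot Require Import Coquelicot.
Import ListNotations.
Open Scope C_scope.

(** The Askey-Wilson function is the sum of the residues of the integrand inside
    the contour. Put [p = q^2]. The integrand is

    F(z)/z,  F(z) = (A z, B z; p)_oo theta(c z, d z; p)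
                    / (a_1 z, a_2 z, a_3 z, a_4 z, b_1/z, b_2/z; p)_oo

    with [c d b_1 b_2 = p]. Its poles inside the contour are the points
    [b_1 p^k] and [b_2 p^k], and the quasi-periodicity of the theta functions
    makes the residues along each progression the terms of a 4phi3 of argument
    [p]. The progression from [b_1] gives the first 4phi3 in the definition of
    the Askey-Wilson function and the one from [b_2] the second; the prefactors
    agree because [theta(p/w; p) = theta(w; p)].

    The origin is an accumulation point of poles. This is dealt with by
    truncating every infinite product, those in the theta functions included,
    after [n] factors. The truncated integrand is a rational function whose
    poles inside the contour are simple: the first [n] points of the two
    progressions, and the origin, with residue exactly [p^n]
    ([simple_residue_at_0]). Its poles outside the contour may be multiple.

    For a rational function the residue theorem is elementary. Partial fractions
    ([partial_fractions], [rational_span]) reduce it to powers, which have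
    primitives except for [1/(z - w)], and the integral of the latter is the
    winding number ([residue_theorem_simple]). The contour winds once around the
    origin because it does so around the points [b_1 p^k], which tend to the
    origin ([inside_0]).

    It remains to let [n] tend to infinity. The truncated integrands converge
    uniformly on the contour ([unif_lim_kernel]), hence so do the integrals
    ([is_cint_unif_lim]). The residues at [b_i p^k] are bounded by [M p^k] with
    [M] independent of [n] ([trunc_residue_bound]), hence their sums converge by
    Tannery's theorem ([tannery]). The outcome is [kernel_contour_integral]. *)

(** * Uniform limits of complex functions *)

Definition unif_lim {X : Type} (D : X -> Prop) (f : nat -> X -> C) (l : X -> C)
  : Prop :=
  forall eps : R, (0 < eps)%R -> exists n0, forall n, (n0 <= n)%nat ->
    forall x, D x -> (Cmod (f n x - l x) < eps)%R.

Definition bounded_on {X : Type} (D : X -> Prop) (l : X -> C) : Prop :=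
  exists M : R, (0 < M)%R /\ forall x, D x -> (Cmod (l x) <= M)%R.

Definition away_from_0 {X : Type} (D : X -> Prop) (l : X -> C) : Prop :=
  exists d : R, (0 < d)%R /\ forall x, D x -> (d <= Cmod (l x))%R.

Lemma Cmod_sub_le (a b c : C) : (Cmod (a - c) <= Cmod (a - b) + Cmod (b - c))%R.
Proof.
  replace (a - c) with ((a - b) + (b - c)) by ring. apply Cmod_triangle.
Qed.

Lemma Cmod_sub_rev (a b : C) : (Cmod a - Cmod b <= Cmod (a - b))%R.
Proof.
  pose proof (Cmod_triangle (a - b) b) as H.
  replace (a - b + b) with a in H by ring. lra.
Qed.

Lemma Cmod_sub_sym (a b : C) : Cmod (a - b) = Cmod (b - a).
Proof. rewrite <- Cmod_opp. f_equal; ring. Qed.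

Section UnifLim.
Context {X : Type} (D : X -> Prop).
Implicit Types (f g : nat -> X -> C) (l m : X -> C).

Lemma unif_lim_ext f g l m :
  (forall n x, D x -> f n x = g n x) -> (forall x, D x -> l x = m x) ->
  unif_lim D f l -> unif_lim D g m.
Proof.
  intros E1 E2 H e he. destruct (H e he) as [n0 Hn]. exists n0. intros n hn x hx.
  rewrite <- E1, <- E2 by assumption. now apply Hn.
Qed.

Lemma unif_lim_const l : unif_lim D (fun _ => l) l.
Proof.
  intros e he; exists O; intros n _ x _.
  replace (l x - l x) with (RtoC 0) by ring. now rewrite Cmod_0.
Qed.

Lemma unif_lim_plus f g l m :
  unif_lim D f l -> unif_lim D g m ->
  unif_lim D (fun n x => f n x + g n x) (fun x => l x + m x).
Proof.
  intros H1 H2 e he.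
  destruct (H1 (e / 2)%R) as [n1 h1]; [lra|].
  destruct (H2 (e / 2)%R) as [n2 h2]; [lra|].
  exists (Nat.max n1 n2). intros n hn x hx.
  specialize (h1 n ltac:(lia) x hx). specialize (h2 n ltac:(lia) x hx).
  replace (f n x + g n x - (l x + m x)) with ((f n x - l x) + (g n x - m x))
    by ring.
  eapply Rle_lt_trans; [apply Cmod_triangle | lra].
Qed.

Lemma unif_lim_mult f g l m :
  bounded_on D l -> bounded_on D m -> unif_lim D f l -> unif_lim D g m ->
  unif_lim D (fun n x => f n x * g n x) (fun x => l x * m x).
Proof.
  intros [A [hA HA]] [B [hB HB]] H1 H2 e he.
  destruct (H1 (Rmin 1 (e / (2 * (B + 1))))) as [n1 h1].
  { apply Rmin_glb_lt; [lra|]. apply Rdiv_lt_0_compat; lra. }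
  destruct (H2 (Rmin 1 (e / (2 * (A + 1))))) as [n2 h2].
  { apply Rmin_glb_lt; [lra|]. apply Rdiv_lt_0_compat; lra. }
  exists (Nat.max n1 n2). intros n hn x hx.
  specialize (h1 n ltac:(lia) x hx). specialize (h2 n ltac:(lia) x hx).
  specialize (HA x hx). specialize (HB x hx).
  replace (f n x * g n x - l x * m x)
    with ((f n x - l x) * g n x + l x * (g n x - m x)) by ring.
  eapply Rle_lt_trans; [apply Cmod_triangle|]. rewrite !Cmod_mult.
  pose proof (Rmin_l 1 (e / (2 * (B + 1)))).
  pose proof (Rmin_r 1 (e / (2 * (B + 1)))).
  pose proof (Rmin_l 1 (e / (2 * (A + 1)))).
  pose proof (Rmin_r 1 (e / (2 * (A + 1)))).
  pose proof (Cmod_sub_rev (g n x) (m x)).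
  pose proof (Cmod_ge_0 (f n x - l x)). pose proof (Cmod_ge_0 (g n x)).
  pose proof (Cmod_ge_0 (l x)). pose proof (Cmod_ge_0 (g n x - m x)).
  assert (F1 : (Cmod (f n x - l x) * Cmod (g n x) <= Cmod (f n x - l x) * (B + 1))%R)
    by (apply Rmult_le_compat_l; lra).
  assert (F2 : (Cmod (f n x - l x) * (B + 1) < e / (2 * (B + 1)) * (B + 1))%R)
    by (apply Rmult_lt_compat_r; lra).
  assert (F3 : (Cmod (l x) * Cmod (g n x - m x) <= (A + 1) * (e / (2 * (A + 1))))%R)
    by (apply Rmult_le_compat; lra).
  replace (e / (2 * (B + 1)) * (B + 1))%R with (e / 2)%R in F2 by (field; lra).
  replace ((A + 1) * (e / (2 * (A + 1))))%R with (e / 2)%R in F3 by (field; lra).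
  lra.
Qed.

Lemma unif_lim_inv f l :
  away_from_0 D l -> unif_lim D f l ->
  unif_lim D (fun n x => / f n x) (fun x => / l x).
Proof.
  intros [d [hd Hd]] H e he.
  destruct (H (Rmin (d / 2) (e * (d * d) / 2))) as [n0 h0].
  { apply Rmin_glb_lt; [lra|].
    apply Rmult_lt_0_compat; [|lra]. apply Rmult_lt_0_compat; [lra|nra]. }
  exists n0. intros n hn x hx. specialize (h0 n hn x hx). specialize (Hd x hx).
  pose proof (Rmin_l (d / 2) (e * (d * d) / 2)).
  pose proof (Rmin_r (d / 2) (e * (d * d) / 2)).
  pose proof (Cmod_sub_rev (l x) (f n x)) as h1. rewrite Cmod_sub_sym in h1.
  assert (hl : l x <> 0) by (apply Cmod_gt_0; lra).
  assert (hf : f n x <> 0) by (apply Cmod_gt_0; lra).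
  replace (/ f n x - / l x) with ((l x - f n x) / (f n x * l x))
    by (field; now split).
  rewrite Cmod_div, Cmod_mult, Cmod_sub_sym by now apply Cmult_neq_0.
  assert (F : (d / 2 * d <= Cmod (f n x) * Cmod (l x))%R)
    by (apply Rmult_le_compat; lra).
  apply Rmult_lt_reg_r with (Cmod (f n x) * Cmod (l x))%R; [nra|].
  unfold Rdiv. rewrite Rmult_assoc, Rinv_l by nra. nra.
Qed.

Lemma bounded_on_const (c : C) : bounded_on D (fun _ => c).
Proof.
  exists (Cmod c + 1)%R. pose proof (Cmod_ge_0 c). split; [lra|]. intros; lra.
Qed.

Lemma bounded_on_mult l m :
  bounded_on D l -> bounded_on D m -> bounded_on D (fun x => l x * m x).
Proof.
  intros [A [hA HA]] [B [hB HB]]. exists (A * B)%R. split; [nra|].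
  intros x hx. rewrite Cmod_mult.
  apply Rmult_le_compat; auto using Cmod_ge_0.
Qed.

Lemma bounded_on_inv l : away_from_0 D l -> bounded_on D (fun x => / l x).
Proof.
  intros [d [hd H]]. exists (/ d)%R. split; [now apply Rinv_0_lt_compat|].
  intros x hx. specialize (H x hx).
  rewrite Cmod_inv by (apply Cmod_gt_0; lra). now apply Rinv_le_contravar.
Qed.

Lemma away_from_0_const (c : C) : c <> 0 -> away_from_0 D (fun _ => c).
Proof.
  intros h. exists (Cmod c). split; [now apply Cmod_gt_0|]. intros; lra.
Qed.

Lemma away_from_0_mult l m :
  away_from_0 D l -> away_from_0 D m -> away_from_0 D (fun x => l x * m x).
Proof.
  intros [A [hA HA]] [B [hB HB]]. exists (A * B)%R. split; [nra|].
  intros x hx. rewrite Cmod_mult. apply Rmult_le_compat; auto; lra.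
Qed.

Lemma away_from_0_inv l : bounded_on D l -> (forall x, D x -> l x <> 0) ->
  away_from_0 D (fun x => / l x).
Proof.
  intros [M [hM H]] h0. exists (/ M)%R. split; [now apply Rinv_0_lt_compat|].
  intros x hx. rewrite Cmod_inv by auto.
  apply Rinv_le_contravar; auto. apply Cmod_gt_0; auto.
Qed.

End UnifLim.

(** Limits of sequences, as the case of a one-point domain: the algebra of
    uniform limits then covers them too. *)
Definition is_Clim (w : nat -> C) (l : C) : Prop :=
  unif_lim (fun _ : unit => True) (fun n _ => w n) (fun _ => l).

Lemma is_Clim_spec (w : nat -> C) (l : C) :
  is_Clim w l <-> forall eps : R, (0 < eps)%R ->
    exists n0, forall n, (n0 <= n)%nat -> (Cmod (w n - l) < eps)%R.
Proof.
  split; intros H e he; destruct (H e he) as [n0 h]; exists n0; intros n hn.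
  - exact (h n hn tt I).
  - intros _ _. now apply h.
Qed.

Lemma is_Clim_ext (w w' : nat -> C) (l : C) :
  (forall n, w n = w' n) -> is_Clim w l -> is_Clim w' l.
Proof. intros E. apply unif_lim_ext; auto. Qed.

Lemma is_Clim_const (c : C) : is_Clim (fun _ => c) c.
Proof. exact (unif_lim_const _ (fun _ => c)). Qed.

Lemma is_Clim_plus (w w' : nat -> C) (l l' : C) :
  is_Clim w l -> is_Clim w' l' -> is_Clim (fun n => w n + w' n) (l + l').
Proof. apply unif_lim_plus. Qed.

Lemma is_Clim_mult (w w' : nat -> C) (l l' : C) :
  is_Clim w l -> is_Clim w' l' -> is_Clim (fun n => w n * w' n) (l * l').
Proof. apply unif_lim_mult; apply bounded_on_const. Qed.

Lemma is_Clim_inv (w : nat -> C) (l : C) :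
  l <> 0 -> is_Clim w l -> is_Clim (fun n => / w n) (/ l).
Proof. intros h. apply unif_lim_inv. now apply away_from_0_const. Qed.

Lemma is_Clim_shift (w : nat -> C) (l : C) (k : nat) :
  is_Clim w l -> is_Clim (fun n => w (n + k)%nat) l.
Proof.
  intros H e he. destruct (H e he) as [n0 h]. exists n0. intros n hn.
  apply h. lia.
Qed.

Lemma is_Clim_unshift (w : nat -> C) (l : C) (k : nat) :
  is_Clim (fun n => w (n + k)%nat) l -> is_Clim w l.
Proof.
  intros H e he. destruct (H e he) as [n0 h]. exists (n0 + k)%nat. intros n hn.
  specialize (h (n - k)%nat). replace (n - k + k)%nat with n in h by lia.
  apply h. lia.
Qed.

Lemma is_Clim_sub (w : nat -> C) (l : C) (k : nat) :
  is_Clim w l -> is_Clim (fun n => w (n - k)%nat) l.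
Proof.
  intros H. apply (is_Clim_unshift _ _ k). revert H. apply is_Clim_ext.
  intros n. f_equal. lia.
Qed.

Lemma is_Clim_bound_le (w : nat -> C) (l c : C) (M : R) :
  is_Clim w l -> (forall n, (Cmod (w n - c) <= M)%R) -> (Cmod (l - c) <= M)%R.
Proof.
  intros H h. apply Rnot_lt_le. intros hlt.
  destruct (proj1 (is_Clim_spec _ _) H (Cmod (l - c) - M)%R) as [n hn]; [lra|].
  specialize (hn n (le_n n)). specialize (h n).
  pose proof (Cmod_sub_le l (w n) c) as h'. rewrite (Cmod_sub_sym l (w n)) in h'.
  lra.
Qed.

Lemma is_Clim_ge (w : nat -> C) (l : C) (d : R) :
  is_Clim w l -> (forall n, (d <= Cmod (w n))%R) -> (d <= Cmod l)%R.
Proof.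
  intros H h. apply Rnot_lt_le. intros hlt.
  destruct (proj1 (is_Clim_spec _ _) H (d - Cmod l)%R) as [n hn]; [lra|].
  specialize (hn n (le_n n)). specialize (h n).
  pose proof (Cmod_sub_rev (w n) l). lra.
Qed.

Lemma is_Clim_unique (w : nat -> C) (l l' : C) :
  is_Clim w l -> is_Clim w l' -> l = l'.
Proof.
  intros H1 H2.
  assert (H : is_Clim (fun n => w n + - (1) * w n) (l + - (1) * l'))
    by (apply is_Clim_plus; [|apply is_Clim_mult]; auto using is_Clim_const).
  assert (h : (Cmod (l + - (1) * l' - 0) <= 0)%R).
  { apply (is_Clim_bound_le _ _ _ _ H). intros n.
    replace (w n + - (1) * w n - 0) with (RtoC 0) by ring. rewrite Cmod_0. lra. }
  replace (l + - (1) * l' - 0) with (l - l') in h by ring.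
  pose proof (Cmod_ge_0 (l - l')).
  assert (h0 : l - l' = 0) by (apply Cmod_eq_0; lra).
  replace l with (l - l' + l') by ring. rewrite h0. ring.
Qed.

Lemma Im_le_Cmod (c : C) : (Rabs (Im c) <= Cmod c)%R.
Proof.
  eapply Rle_trans; [apply Rmax_r | apply (Rmax_Cmod c)].
Qed.

Lemma Clim_seq_unique (w : nat -> C) (l : C) : is_Clim w l -> Clim_seq w = l.
Proof.
  intros H. pose proof (proj1 (is_Clim_spec _ _) H) as h.
  unfold Clim_seq.
  rewrite (is_lim_seq_unique (fun n => Re (w n)) (Finite (Re l))),
    (is_lim_seq_unique (fun n => Im (w n)) (Finite (Im l))).
  - simpl. now destruct l.
  - apply is_lim_seq_spec. intros e. destruct (h e (cond_pos e)) as [n0 hn].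
    exists n0. intros n hn'. eapply Rle_lt_trans; [|apply (hn n hn')].
    eapply Rle_trans; [|apply Im_le_Cmod].
    unfold Cminus. rewrite im_plus, im_opp. apply Rle_refl.
  - apply is_lim_seq_spec. intros e. destruct (h e (cond_pos e)) as [n0 hn].
    exists n0. intros n hn'. eapply Rle_lt_trans; [|apply (hn n hn')].
    eapply Rle_trans; [|apply re_le_Cmod].
    unfold Cminus. rewrite re_plus, re_opp. apply Rle_refl.
Qed.

Lemma pow_lt_eventually (M rho eps : R) : (0 <= M)%R -> (0 < rho < 1)%R ->
  (0 < eps)%R -> exists n0, forall n, (n0 <= n)%nat -> (M * rho ^ n < eps)%R.
Proof.
  intros hM hr he.
  destruct (pow_lt_1_zero rho) with (y := (eps / (M + 1))%R) as [n0 h].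
  - rewrite Rabs_pos_eq; lra.
  - apply Rdiv_lt_0_compat; lra.
  - exists n0. intros n hn. specialize (h n hn).
    assert (hp : (0 < rho ^ n)%R) by (apply pow_lt; lra).
    rewrite Rabs_pos_eq in h by lra.
    apply Rmult_lt_compat_l with (r := (M + 1)%R) in h; [|lra].
    replace ((M + 1) * (eps / (M + 1)))%R with eps in h by (field; lra). lra.
Qed.

(** The explicit rate is what makes the convergence of infinite products
    uniform in their argument. *)
Lemma geometric_cauchy (w : nat -> C) (K rho : R) :
  (0 <= K)%R -> (0 < rho < 1)%R ->
  (forall n, (Cmod (w (S n) - w n) <= K * rho ^ n)%R) ->
  exists l, is_Clim w l
    /\ forall n, (Cmod (w n - l) <= K / (1 - rho) * rho ^ n)%R.
Proof.
  intros hK hr H.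
  assert (hd : forall m n,
    (Cmod (w (n + m)%nat - w n) <= K / (1 - rho) * rho ^ n * (1 - rho ^ m))%R).
  { intros m n. induction m as [|m IH].
    - rewrite Nat.add_0_r. replace (w n - w n) with (RtoC 0) by ring.
      rewrite Cmod_0. simpl. lra.
    - rewrite Nat.add_succ_r.
      eapply Rle_trans; [apply (Cmod_sub_le _ (w (n + m)%nat))|].
      eapply Rle_trans; [apply Rplus_le_compat; [apply H|apply IH]|].
      rewrite pow_add. simpl. apply Req_le. field. lra. }
  assert (hb : forall m n,
    (Cmod (w (n + m)%nat - w n) <= K / (1 - rho) * rho ^ n)%R).
  { intros m n. eapply Rle_trans; [apply hd|].
    assert (0 < rho ^ m)%R by (apply pow_lt; lra).
    assert (0 < rho ^ n)%R by (apply pow_lt; lra).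
    assert (0 <= K / (1 - rho))%R by (apply Rdiv_le_0_compat; lra).
    rewrite <- (Rmult_1_r (K / (1 - rho) * rho ^ n)) at 2.
    apply Rmult_le_compat_l; [|lra]. apply Rmult_le_pos; lra. }
  assert (hK' : (0 <= K / (1 - rho))%R) by (apply Rdiv_le_0_compat; lra).
  assert (hc : forall P : C -> R, (forall c, (Rabs (P c) <= Cmod c)%R) ->
    (forall a b, P (a - b) = (P a - P b)%R) ->
    ex_finite_lim_seq (fun n => P (w n))).
  { intros P hP hP'. apply ex_lim_seq_cauchy_corr. intros e.
    destruct (pow_lt_eventually (K / (1 - rho)) rho e hK' hr (cond_pos e))
      as [n0 h].
    assert (aux : forall n m, (n0 <= n)%nat -> (n <= m)%nat ->
      (Rabs (P (w m) - P (w n)) < e)%R).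
    { intros n m hn hm. rewrite <- hP'. eapply Rle_lt_trans; [apply hP|].
      replace m with (n + (m - n))%nat by lia.
      eapply Rle_lt_trans; [apply hb | now apply h]. }
    exists n0. intros n m hn hm. destruct (Nat.le_ge_cases n m).
    - rewrite Rabs_minus_sym. now apply aux.
    - now apply aux. }
  destruct (hc Re re_le_Cmod) as [lr hlr].
  { intros a b. unfold Cminus. now rewrite re_plus, re_opp. }
  destruct (hc Im Im_le_Cmod) as [li hli].
  { intros a b. unfold Cminus. now rewrite im_plus, im_opp. }
  assert (hl : is_Clim w (lr, li)).
  { apply is_Clim_spec. intros e he.
    apply is_lim_seq_spec in hlr, hli.
    assert (he2 : (0 < e / 2)%R) by lra.
    destruct (hlr (mkposreal _ he2)) as [n1 h1].
    destruct (hli (mkposreal _ he2)) as [n2 h2]. simpl in h1, h2.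
    exists (Nat.max n1 n2). intros n hn.
    specialize (h1 n ltac:(lia)). specialize (h2 n ltac:(lia)).
    eapply Rle_lt_trans; [apply Cmod_2Rmax|].
    replace (fst (w n - (lr, li))) with (Re (w n) - lr)%R by reflexivity.
    replace (snd (w n - (lr, li))) with (Im (w n) - li)%R by reflexivity.
    assert (hs : (0 < sqrt 2 < 2)%R).
    { pose proof (sqrt_lt_R0 2 ltac:(lra)). pose proof (sqrt_sqrt 2 ltac:(lra)).
      split; [lra | nra]. }
    assert (hm : (Rmax (Rabs (Re (w n) - lr)) (Rabs (Im (w n) - li)) < e / 2)%R)
      by (now apply Rmax_lub_lt).
    pose proof (Rabs_pos (Re (w n) - lr)).
    pose proof (Rmax_l (Rabs (Re (w n) - lr)) (Rabs (Im (w n) - li))). nra. }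
  exists (lr, li). split; [exact hl|]. intros n. rewrite Cmod_sub_sym.
  apply (is_Clim_bound_le (fun m => w (m + n)%nat)).
  - now apply is_Clim_shift.
  - intros m. rewrite Nat.add_comm. apply hb.
Qed.

(** * Finite and infinite shifted factorials *)

Lemma RtoC_neq_0 (r : R) : r <> 0%R -> RtoC r <> 0.
Proof. intros h E. apply h. exact (f_equal fst E). Qed.

Section QPoch.
Context (p : R) (hp : (0 < p < 1)%R).

Lemma pow_p_pos (k : nat) : (0 < p ^ k)%R.
Proof. apply pow_lt; lra. Qed.

Lemma pow_p_neq_0 (k : nat) : RtoC (p ^ k) <> 0.
Proof. apply RtoC_neq_0. pose proof (pow_p_pos k). lra. Qed.

Lemma Cmod_pow_p (k : nat) : Cmod (RtoC (p ^ k)) = (p ^ k)%R.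
Proof. rewrite Cmod_R. apply Rabs_pos_eq. pose proof (pow_p_pos k). lra. Qed.

Lemma pow_p_le_1 (k : nat) : (p ^ k <= 1)%R.
Proof.
  induction k as [|k IH]; simpl; [lra|].
  pose proof (pow_p_pos k). nra.
Qed.

Lemma Cmod_mult_pow_p_le (a : C) (k : nat) : (Cmod (a * (p ^ k)%R) <= Cmod a)%R.
Proof.
  rewrite Cmod_mult, Cmod_pow_p. pose proof (pow_p_le_1 k).
  pose proof (Cmod_ge_0 a). nra.
Qed.

Lemma qpoch_n_add (a : C) (m n : nat) :
  qpoch_n a p (m + n) = qpoch_n a p m * qpoch_n (a * (p ^ m)%R) p n.
Proof.
  induction n as [|n IH].
  - rewrite Nat.add_0_r. simpl. ring.
  - rewrite Nat.add_succ_r. cbn [qpoch_n]. rewrite IH, pow_add, RtoC_mult. ring.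
Qed.

Lemma qpoch_n_succ_l (a : C) (n : nat) :
  qpoch_n a p (S n) = (1 - a) * qpoch_n (a * p) p n.
Proof.
  change (S n) with (1 + n)%nat. rewrite qpoch_n_add. simpl.
  rewrite Rmult_1_r. ring.
Qed.

Lemma qpoch_n_neq_0 (a : C) (n : nat) :
  (forall k, 1 - a * (p ^ k)%R <> 0) -> qpoch_n a p n <> 0.
Proof.
  intros h. induction n as [|n IH]; cbn [qpoch_n].
  - apply RtoC_neq_0. lra.
  - now apply Cmult_neq_0.
Qed.

Lemma qpoch_n_factor_neq_0 (a : C) :
  (forall n, qpoch_n a p n <> 0) -> forall k, 1 - a * (p ^ k)%R <> 0.
Proof.
  intros h k E. apply (h (S k)). cbn [qpoch_n]. rewrite E. ring.
Qed.

Lemma qpoch_n_bound (B : R) : (0 <= B)%R -> exists M : R, (0 < M)%R /\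
  forall a n, (Cmod a <= B)%R -> (Cmod (qpoch_n a p n) <= M)%R.
Proof.
  intros hB. exists (exp (B / (1 - p))). split; [apply exp_pos|].
  intros a n ha.
  assert (h : (Cmod (qpoch_n a p n) <= exp (B / (1 - p) * (1 - p ^ n)))%R).
  { induction n as [|n IH]; cbn [qpoch_n].
    - rewrite Cmod_1. simpl. rewrite Rminus_diag, Rmult_0_r, exp_0. lra.
    - rewrite Cmod_mult.
      replace (B / (1 - p) * (1 - p ^ S n))%R
        with (B / (1 - p) * (1 - p ^ n) + B * p ^ n)%R by (simpl; field; lra).
      rewrite exp_plus. apply Rmult_le_compat; auto using Cmod_ge_0.
      apply Rle_trans with (1 + B * p ^ n)%R; [|apply exp_ineq1_le].
      unfold Cminus. eapply Rle_trans; [apply Cmod_triangle|].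
      rewrite Cmod_1, Cmod_opp, Cmod_mult, Cmod_pow_p.
      pose proof (pow_p_pos n). nra. }
  eapply Rle_trans; [exact h|].
  assert (hK : (0 <= B / (1 - p))%R) by (apply Rdiv_le_0_compat; lra).
  pose proof (pow_p_pos n).
  destruct (Rle_lt_or_eq_dec (B / (1 - p) * (1 - p ^ n)) (B / (1 - p))) as [H1|H1].
  - nra.
  - now apply Rlt_le, exp_increasing.
  - rewrite H1. apply Rle_refl.
Qed.

Lemma qpoch_n_rate (B : R) : (0 <= B)%R -> exists M : R, (0 <= M)%R /\
  forall a, (Cmod a <= B)%R -> is_Clim (qpoch_n a p) (qpoch a p) /\
    forall n, (Cmod (qpoch_n a p n - qpoch a p) <= M * p ^ n)%R.
Proof.
  intros hB. destruct (qpoch_n_bound B hB) as [M [hM H]].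
  exists (M * B / (1 - p))%R. split.
  { apply Rdiv_le_0_compat; nra. }
  intros a ha.
  destruct (geometric_cauchy (qpoch_n a p) (M * B) p) as [l [hl hr]];
    [nra|exact hp| |].
  - intros n. cbn [qpoch_n].
    replace (qpoch_n a p n * (1 - a * (p ^ n)%R) - qpoch_n a p n)
      with (- (qpoch_n a p n * (a * (p ^ n)%R))) by ring.
    rewrite Cmod_opp, !Cmod_mult, Cmod_pow_p, <- Rmult_assoc.
    apply Rmult_le_compat_r; [pose proof (pow_p_pos n); lra|].
    apply Rmult_le_compat; auto using Cmod_ge_0.
  - replace (qpoch a p) with l; [now split|].
    symmetry. now apply Clim_seq_unique.
Qed.

Lemma is_Clim_qpoch (a : C) : is_Clim (qpoch_n a p) (qpoch a p).
Proof.
  destruct (qpoch_n_rate (Cmod a) (Cmod_ge_0 a)) as [M [_ H]].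
  now apply H, Rle_refl.
Qed.

Lemma qpoch_split (a : C) (k : nat) :
  qpoch a p = qpoch_n a p k * qpoch (a * (p ^ k)%R) p.
Proof.
  apply (is_Clim_unique (fun n => qpoch_n a p (n + k))).
  - apply is_Clim_shift, is_Clim_qpoch.
  - eapply is_Clim_ext; [|apply is_Clim_mult;
      [apply is_Clim_const | apply is_Clim_qpoch]].
    intros n. now rewrite Nat.add_comm, qpoch_n_add.
Qed.

Lemma qpoch_neq_0_n (a : C) (n : nat) : qpoch a p <> 0 -> qpoch_n a p n <> 0.
Proof. intros h E. apply h. rewrite (qpoch_split a n), E. ring. Qed.

(** A product of factors [1 - x_j] is at least [1] minus the sum of the [x_j],
    and the [|a| p^j] add up to [|a| / (1 - p)]. *)
Lemma qpoch_n_ge_half (a : C) (n : nat) :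
  (Cmod a <= (1 - p) / 2)%R -> (1 / 2 <= Cmod (qpoch_n a p n))%R.
Proof.
  intros ha.
  assert (h : (1 - (1 - p ^ n) / 2 <= Cmod (qpoch_n a p n))%R).
  { induction n as [|n IH]; cbn [qpoch_n].
    - rewrite Cmod_1. simpl. lra.
    - rewrite Cmod_mult.
      assert (h1 : (1 - (1 - p) / 2 * p ^ n <= Cmod (1 - a * (p ^ n)%R))%R).
      { pose proof (Cmod_sub_rev 1 (a * (p ^ n)%R)) as h.
        rewrite Cmod_1, Cmod_mult, Cmod_pow_p in h.
        pose proof (pow_p_pos n). nra. }
      pose proof (pow_p_pos n). pose proof (pow_p_le_1 n).
      apply Rle_trans
        with ((1 - (1 - p ^ n) / 2) * (1 - (1 - p) / 2 * p ^ n))%R.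
      + simpl. assert (0 <= (1 - p ^ n) * ((1 - p) * p ^ n))%R; [|lra].
        repeat apply Rmult_le_pos; lra.
      + assert (0 <= (1 - p) * (1 - p ^ n))%R by (apply Rmult_le_pos; lra).
        apply Rmult_le_compat; lra. }
  pose proof (pow_p_pos n). lra.
Qed.

Section OnDomain.
Context {X : Type} (D : X -> Prop).

Lemma unif_lim_qpoch (h : X -> C) : bounded_on D h ->
  unif_lim D (fun n x => qpoch_n (h x) p n) (fun x => qpoch (h x) p).
Proof.
  intros [B [hB HB]] e he.
  destruct (qpoch_n_rate B) as [M [hM H]]; [lra|].
  destruct (pow_lt_eventually M p e hM hp he) as [n0 hn].
  exists n0. intros n hn' x hx. eapply Rle_lt_trans; [|apply (hn n hn')].
  now apply H, HB.
Qed.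

Lemma bounded_on_qpoch (h : X -> C) :
  bounded_on D h -> bounded_on D (fun x => qpoch (h x) p).
Proof.
  intros [B [hB HB]]. destruct (qpoch_n_bound B) as [M [hM H]]; [lra|].
  exists M. split; [exact hM|]. intros x hx.
  replace (qpoch (h x) p) with (qpoch (h x) p - 0) by ring.
  apply (is_Clim_bound_le (qpoch_n (h x) p)); [apply is_Clim_qpoch|].
  intros n. replace (qpoch_n (h x) p n - 0) with (qpoch_n (h x) p n) by ring.
  now apply H, HB.
Qed.

(** One lower bound for all truncations: finitely many factors are handled one
    by one and [qpoch_n_ge_half] takes care of the rest. *)
Lemma qpoch_n_away (h : X -> C) : bounded_on D h ->
  (forall k, away_from_0 D (fun x => 1 - h x * (p ^ k)%R)) ->
  exists d : R, (0 < d)%R /\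
    forall n x, D x -> (d <= Cmod (qpoch_n (h x) p n))%R.
Proof.
  intros [B [hB HB]] hk.
  assert (hfin : forall m, exists d : R, (0 < d)%R /\ forall n x, (n <= m)%nat ->
    D x -> (d <= Cmod (qpoch_n (h x) p n))%R).
  { induction m as [|m [d [hd H]]].
    - exists 1%R. split; [lra|]. intros n x hn hx.
      replace n with O by lia. simpl. rewrite Cmod_1. lra.
    - destruct (hk m) as [d' [hd' H']]. exists (Rmin d (d * d')). split.
      { apply Rmin_glb_lt; nra. }
      intros n x hn hx.
      destruct (Nat.eq_dec n (S m)) as [->|hne].
      + eapply Rle_trans; [apply Rmin_r|]. cbn [qpoch_n]. rewrite Cmod_mult.
        apply Rmult_le_compat; auto; lra.
      + eapply Rle_trans; [apply Rmin_l|]. apply H; [lia|exact hx]. }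
  destruct (pow_lt_eventually B p ((1 - p) / 2)) as [m hm]; [lra|exact hp|lra|].
  destruct (hfin m) as [d [hd H]].
  exists (Rmin d (d * (1 / 2))). split; [apply Rmin_glb_lt; nra|].
  intros n x hx. destruct (Nat.le_gt_cases n m) as [hn|hn].
  - eapply Rle_trans; [apply Rmin_l|]. now apply H.
  - eapply Rle_trans; [apply Rmin_r|].
    replace n with (m + (n - m))%nat by lia. rewrite qpoch_n_add, Cmod_mult.
    apply Rmult_le_compat; [lra|lra|now apply H|].
    apply qpoch_n_ge_half. rewrite Cmod_mult, Cmod_pow_p.
    eapply Rle_trans; [|apply Rlt_le, (hm m (le_n m))].
    apply Rmult_le_compat_r; [pose proof (pow_p_pos m); lra | auto].
Qed.

Lemma away_from_0_qpoch (h : X -> C) : bounded_on D h ->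
  (forall k, away_from_0 D (fun x => 1 - h x * (p ^ k)%R)) ->
  away_from_0 D (fun x => qpoch (h x) p).
Proof.
  intros hb hk. destruct (qpoch_n_away h hb hk) as [d [hd H]].
  exists d. split; [exact hd|]. intros x hx.
  apply (is_Clim_ge (qpoch_n (h x) p)); [apply is_Clim_qpoch|].
  intros n. now apply H.
Qed.

End OnDomain.

Lemma qpoch_n_lower (a : C) : (forall k, 1 - a * (p ^ k)%R <> 0) ->
  exists d : R, (0 < d)%R /\ forall n, (d <= Cmod (qpoch_n a p n))%R.
Proof.
  intros h. destruct (qpoch_n_away (fun _ : unit => True) (fun _ => a))
    as [d [hd H]].
  - apply bounded_on_const.
  - intros k. now apply away_from_0_const.
  - exists d. split; [exact hd|]. intros n. exact (H n tt I).
Qed.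

Lemma qpoch_neq_0 (a : C) : (forall k, 1 - a * (p ^ k)%R <> 0) -> qpoch a p <> 0.
Proof.
  intros h. destruct (qpoch_n_lower a h) as [d [hd H]].
  apply Cmod_gt_0. apply Rlt_le_trans with d; [exact hd|].
  exact (is_Clim_ge _ _ _ (is_Clim_qpoch a) H).
Qed.

(** The power [p^(k(k-1)/2)]. *)
Fixpoint ptri (k : nat) : C :=
  match k with O => 1 | S j => ptri j * (p ^ j)%R end.

Lemma ptri_neq_0 (k : nat) : ptri k <> 0.
Proof.
  induction k as [|k IH]; cbn [ptri]; [apply RtoC_neq_0; lra|].
  apply Cmult_neq_0; [exact IH | apply pow_p_neq_0].
Qed.

(** Read backwards, the factors on the left are [1 - p^(-j) / c] with [j < k],
    which are the products of [1 - c p^j] and the monomials [- p^(-j) / c]. *)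
Lemma qpoch_n_reverse (c : C) (k : nat) : c <> 0 ->
  qpoch_n (p / (c * (p ^ k)%R)) p k = (- / c) ^ k / ptri k * qpoch_n c p k.
Proof.
  intros hc. pose proof (RtoC_neq_0 p ltac:(lra)) as hp0.
  induction k as [|k IH].
  - simpl. field.
  - pose proof (ptri_neq_0 k). pose proof (pow_p_neq_0 k).
    rewrite qpoch_n_succ_l. cbn [ptri qpoch_n]. rewrite Cpow_S.
    replace (p / (c * (p ^ S k)%R) * p) with (p / (c * (p ^ k)%R)).
    + rewrite IH. simpl (p ^ S k)%R. rewrite RtoC_mult. field. auto.
    + simpl (p ^ S k)%R. rewrite RtoC_mult. field. auto.
Qed.

Lemma qpoch_n_reverse_add (c : C) (k n : nat) : c <> 0 ->
  qpoch_n (p / (c * (p ^ k)%R)) p (k + n)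
  = (- / c) ^ k / ptri k * qpoch_n c p k * qpoch_n (p / c) p n.
Proof.
  intros hc. rewrite qpoch_n_add, qpoch_n_reverse by exact hc. f_equal. f_equal.
  pose proof (pow_p_neq_0 k). field. auto.
Qed.

End QPoch.

(** * Rational functions and partial fractions *)

(** Division is total, so that identities between rational functions fail at
    the poles; [rational_ext] therefore asks for them off [O] only. *)
Inductive rational_off (O : C -> Prop) : (C -> C) -> Prop :=
| rational_const c : rational_off O (fun _ => c)
| rational_id : rational_off O (fun z => z)
| rational_pole w : O w -> rational_off O (fun z => / (z - w))
| rational_plus f h : rational_off O f -> rational_off O h ->
    rational_off O (fun z => f z + h z)
| rational_mult f h : rational_off O f -> rational_off O h ->
    rational_off O (fun z => f z * h z)
| rational_ext f h : (forall z, ~ O z -> f z = h z) -> rational_off O f ->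
    rational_off O h.

Lemma Cminus_neq_0 (a b : C) : a <> b -> a - b <> 0.
Proof.
  intros h E. apply h. replace a with (a - b + b) by ring. rewrite E. ring.
Qed.

Lemma rational_difference_quotient (O : C -> Prop) (f : C -> C) (v : C) :
  rational_off O f -> ~ O v -> exists h, rational_off O h /\
    forall z, ~ O z -> f z = f v + (z - v) * h z.
Proof.
  intros hf hv.
  induction hf as [c| |w hw|f1 f2 r1 [h1 [k1 e1]] r2 [h2 [k2 e2]]
    |f1 f2 r1 [h1 [k1 e1]] r2 [h2 [k2 e2]]|f1 f2 e r1 [h1 [k1 e1]]].
  - exists (fun _ => RtoC 0). split; [apply rational_const|]. intros; ring.
  - exists (fun _ => RtoC 1). split; [apply rational_const|]. intros; ring.
  - exists (fun z => - / (v - w) * / (z - w)). split.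
    + apply rational_mult; [apply rational_const | now apply rational_pole].
    + intros z hz. field.
      split; apply Cminus_neq_0; congruence.
  - exists (fun z => h1 z + h2 z). split; [now apply rational_plus|].
    intros z hz. rewrite (e1 z hz), (e2 z hz) at 1. ring.
  - exists (fun z => h1 z * f2 z + f1 v * h2 z). split.
    + apply rational_plus; apply rational_mult; auto. apply rational_const.
    + intros z hz. rewrite (e1 z hz). rewrite (e2 z hz) at 1 2. ring.
  - exists h1. split; [exact k1|].
    intros z hz. rewrite <- !e by assumption. now apply e1.
Qed.

Definition Csum (l : list C) : C := fold_right Cplus 0 l.

Lemma Csum_cons (a : C) (l : list C) : Csum (a :: l) = a + Csum l.
Proof. reflexivity. Qed.

Lemma Cprod_cons (a : C) (l : list C) : Cprod (a :: l) = a * Cprod l.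
Proof. reflexivity. Qed.

(** Makes the derivative of the polynomial with roots [V], at one of these roots,
    a product over the whole list [V]. *)
Definition punctured (w v : C) : C := if Ceq_dec w v then 1 else w - v.

Lemma punctured_neq (w v : C) : w <> v -> punctured w v = w - v.
Proof. intros h. unfold punctured. now destruct (Ceq_dec w v). Qed.

Lemma punctured_eq (w : C) : punctured w w = 1.
Proof. unfold punctured. now destruct (Ceq_dec w w). Qed.

Definition simple_residue (f : C -> C) (V : list C) (w : C) : C :=
  f w / Cprod (map (punctured w) V).

Lemma Cprod_neq_0 (l : list C) : (forall a, In a l -> a <> 0) -> Cprod l <> 0.
Proof.
  induction l as [|a l IH]; intros h; unfold Cprod; simpl.
  - apply RtoC_neq_0. lra.
  - apply Cmult_neq_0; [apply h; now left | apply IH; intros; apply h; now right].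
Qed.

Lemma Cprod_punctured (V : list C) (z : C) : ~ In z V ->
  Cprod (map (punctured z) V) = Cprod (map (fun v => z - v) V).
Proof.
  intros h. f_equal. apply map_ext_in. intros v hv. apply punctured_neq.
  intros ->. now apply h.
Qed.

Lemma Cprod_punctured_neq_0 (V : list C) (w : C) :
  Cprod (map (punctured w) V) <> 0.
Proof.
  apply Cprod_neq_0. intros a ha. apply in_map_iff in ha.
  destruct ha as [v [<- _]]. unfold punctured. destruct (Ceq_dec w v) as [_|h].
  - apply RtoC_neq_0; lra.
  - now apply Cminus_neq_0.
Qed.

Lemma Csum_map_scal {T} (c : C) (f : T -> C) (l : list T) :
  Csum (map (fun x => c * f x) l) = c * Csum (map f l).
Proof.
  induction l as [|a l IH]; unfold Csum in *; simpl; [|rewrite IH]; ring.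
Qed.

Lemma Csum_map_plus {T} (f h : T -> C) (l : list T) :
  Csum (map (fun x => f x + h x) l) = Csum (map f l) + Csum (map h l).
Proof.
  induction l as [|a l IH]; unfold Csum in *; simpl; [|rewrite IH]; ring.
Qed.

(** Dividing once more by [z - v] splits each simple fraction in two, and the
    residue at the new pole is the value of the previous expansion at [v]. *)
Lemma partial_fractions (O : C -> Prop) (f : C -> C) (V : list C) :
  rational_off O f -> NoDup V -> (forall v, In v V -> ~ O v) ->
  exists h, rational_off O h /\ forall z, ~ O z -> ~ In z V ->
    f z / Cprod (map (fun v => z - v) V)
    = h z + Csum (map (fun w => simple_residue f V w / (z - w)) V).
Proof.
  intros hf. induction V as [|v V IH]; intros hnd hO.
  - exists f. split; [exact hf|]. intros. unfold Cprod, Csum. simpl. field.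
  - inversion_clear hnd as [|? ? hv hnd'].
    destruct IH as [h [hh E]]; [exact hnd'|intros w hw; apply hO; now right|].
    assert (hvO : ~ O v) by (apply hO; now left).
    destruct (rational_difference_quotient O h v hh hvO) as [h1 [hh1 E1]].
    exists h1. split; [exact hh1|]. intros z hz hzV.
    assert (hzv : z - v <> 0)
      by (apply Cminus_neq_0; intros ->; apply hzV; now left).
    assert (hzV' : ~ In z V) by (intros H; apply hzV; now right).
    assert (Ev : simple_residue f (v :: V) v
      = h v + Csum (map (fun w => simple_residue f V w / (v - w)) V)).
    { rewrite <- E, <- Cprod_punctured by assumption.
      unfold simple_residue. cbn [map]. rewrite Cprod_cons, punctured_eq.
      now rewrite Cmult_1_l. }
    assert (Ew : forall w, In w V ->
      simple_residue f (v :: V) w = simple_residue f V w / (w - v)).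
    { intros w hw. assert (hwv : w <> v) by congruence.
      unfold simple_residue. cbn [map]. rewrite Cprod_cons, punctured_neq by exact hwv.
      field. split; [apply Cprod_punctured_neq_0|].
      now apply Cminus_neq_0. }
    cbn [map]. rewrite Csum_cons, Ev.
    rewrite (map_ext_in (fun w => simple_residue f (v :: V) w / (z - w))
      (fun w => / (z - v) * (simple_residue f V w / (z - w))
        + - / (z - v) * (simple_residue f V w / (v - w)))).
    + rewrite Csum_map_plus, !Csum_map_scal.
      rewrite Cprod_cons.
      transitivity (/ (z - v) * (f z / Cprod (map (fun v => z - v) V))).
      * field. split; [|exact hzv].
        rewrite <- Cprod_punctured by exact hzV'. apply Cprod_punctured_neq_0.
      * rewrite E, (E1 z hz) by assumption. field. exact hzv.
    + intros w hw. rewrite Ew by exact hw. field.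
      repeat split; try exact hzv; apply Cminus_neq_0; congruence.
Qed.

(** Linear combinations of powers and of partial fractions: of these, only the
    first power [/ (z - w)] has no primitive. *)
Inductive fraction_span (O : C -> Prop) : (C -> C) -> Prop :=
| span_pow n : fraction_span O (fun z => z ^ n)
| span_pole w n : O w -> fraction_span O (fun z => (/ (z - w)) ^ S n)
| span_plus f h : fraction_span O f -> fraction_span O h ->
    fraction_span O (fun z => f z + h z)
| span_scal c f : fraction_span O f -> fraction_span O (fun z => c * f z)
| span_ext f h : (forall z, ~ O z -> f z = h z) -> fraction_span O f ->
    fraction_span O h.

Lemma span_mult_id (O : C -> Prop) (f : C -> C) :
  fraction_span O f -> fraction_span O (fun z => z * f z).
Proof.
  intros hf. induction hf as [n|w n hw|f h hf IHf hh IHh|c f hf IHf|f h e hf IHf].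
  - exact (span_pow O (S n)).
  - apply (span_ext O (fun z => (/ (z - w)) ^ n + w * (/ (z - w)) ^ S n)).
    { intros z hz. rewrite Cpow_S. field. apply Cminus_neq_0. congruence. }
    apply span_plus; [|now apply span_scal, span_pole].
    destruct n; [|now apply span_pole].
    now apply (span_ext O (fun z => z ^ 0)); [|apply span_pow].
  - apply (span_ext O (fun z => z * f z + z * h z)); [intros; ring|].
    now apply span_plus.
  - apply (span_ext O (fun z => c * (z * f z))); [intros; ring|].
    now apply span_scal.
  - apply (span_ext O (fun z => z * f z)); [|exact IHf].
    intros z hz. now rewrite e.
Qed.

Lemma span_mult_pole (O : C -> Prop) (v : C) (f : C -> C) : O v ->
  fraction_span O f -> fraction_span O (fun z => / (z - v) * f z).
Proof.
  intros hv hf.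
  assert (h0 : fraction_span O (fun z => / (z - v))).
  { apply (span_ext O (fun z => (/ (z - v)) ^ 1)); [|now apply span_pole].
    intros. apply Cpow_1_r. }
  induction hf as [n|w n hw|f h hf IHf hh IHh|c f hf IHf|f h e hf IHf].
  - induction n as [|n IH].
    + apply (span_ext O (fun z => / (z - v))); [|exact h0].
      intros. simpl. ring.
    + apply (span_ext O (fun z => z ^ n + v * (/ (z - v) * z ^ n))).
      { intros z hz. rewrite Cpow_S. field. apply Cminus_neq_0. congruence. }
      apply span_plus; [apply span_pow | now apply span_scal].
  - destruct (Ceq_dec w v) as [->|hne]; [exact (span_pole O v (S n) hv)|].
    assert (hne' : w - v <> 0) by now apply Cminus_neq_0.
    assert (H : forall m, fraction_span O (fun z => / (z - v) * (/ (z - w)) ^ m)).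
    { induction m as [|m IH].
      - apply (span_ext O (fun z => / (z - v))); [|exact h0].
        intros. simpl. ring.
      - apply (span_ext O (fun z => / (w - v) *
          ((/ (z - w)) ^ S m + - (1) * (/ (z - v) * (/ (z - w)) ^ m)))).
        { intros z hz. rewrite Cpow_S. field.
          repeat split; try exact hne'; apply Cminus_neq_0; congruence. }
        apply span_scal, span_plus; [now apply span_pole | now apply span_scal]. }
    apply H.
  - apply (span_ext O (fun z => / (z - v) * f z + / (z - v) * h z));
      [intros; ring|]. now apply span_plus.
  - apply (span_ext O (fun z => c * (/ (z - v) * f z))); [intros; ring|].
    now apply span_scal.
  - apply (span_ext O (fun z => / (z - v) * f z)); [|exact IHf].
    intros z hz. now rewrite e.
Qed.

(** The generators of the rational functions act on the span by multiplication,
    which avoids any discussion of common denominators and multiplicities. *)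
Lemma rational_span (O : C -> Prop) (f : C -> C) :
  rational_off O f -> fraction_span O f.
Proof.
  intros hf.
  assert (H : forall h, fraction_span O h -> fraction_span O (fun z => f z * h z)).
  { induction hf as [c| |w hw|f1 f2 r1 IH1 r2 IH2|f1 f2 r1 IH1 r2 IH2|f1 f2 e r1 IH1];
      intros h hh.
    - now apply span_scal.
    - now apply span_mult_id.
    - now apply span_mult_pole.
    - apply (span_ext O (fun z => f1 z * h z + f2 z * h z)); [intros; ring|].
      apply span_plus; auto.
    - apply (span_ext O (fun z => f1 z * (f2 z * h z))); [intros; ring|]. auto.
    - apply (span_ext O (fun z => f1 z * h z)); [|auto].
      intros z hz. now rewrite e. }
  apply (span_ext O (fun z => f z * z ^ 0)); [intros; simpl; ring|].
  apply H, span_pow.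
Qed.

(** * Contour integrals of rational functions *)

Lemma is_derive_C_pair (f h : R -> R) (x a b : R) :
  is_derive f x a -> is_derive h x b ->
  is_derive (K := R_AbsRing) (V := C_R_NormedModule) (fun r => (f r, h r)) x (a, b).
Proof.
  intros Hf Hh.
  apply (filterdiff_comp'_2 f h (fun a b => (a, b) : C_R_NormedModule) x
    (fun y => scal y a) (fun y => scal y b) (fun a b => (a, b)) Hf Hh).
  apply (filterdiff_ext_lin _ (fun t => t)).
  - apply (filterdiff_ext (fun t => t)); [now intros []|]. apply filterdiff_id.
  - now intros [].
Qed.

Lemma is_derive_C_fst (F : R -> C) (x : R) (l : C) :
  is_derive (K := R_AbsRing) (V := C_R_NormedModule) F x l ->
  is_derive (fun r => fst (F r)) x (fst l).
Proof.
  intros H.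
  apply (filterdiff_comp' F (fun t : C_R_NormedModule => fst t) x _ (fun t => fst t) H).
  apply filterdiff_linear, is_linear_fst.
Qed.

Lemma is_derive_C_snd (F : R -> C) (x : R) (l : C) :
  is_derive (K := R_AbsRing) (V := C_R_NormedModule) F x l ->
  is_derive (fun r => snd (F r)) x (snd l).
Proof.
  intros H.
  apply (filterdiff_comp' F (fun t : C_R_NormedModule => snd t) x _ (fun t => snd t) H).
  apply filterdiff_linear, is_linear_snd.
Qed.

Definition is_Cderive (F : R -> C) (x : R) (l : C) : Prop :=
  is_derive (K := R_AbsRing) (V := C_R_NormedModule) F x l.

Lemma is_Cderive_components (F : R -> C) (x : R) (l : C) :
  is_derive (fun r => fst (F r)) x (fst l) ->
  is_derive (fun r => snd (F r)) x (snd l) -> is_Cderive F x l.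
Proof.
  intros H1 H2. rewrite (surjective_pairing l).
  apply (is_derive_ext (fun r => (fst (F r), snd (F r)))).
  - intros t. symmetry. exact (surjective_pairing (F t)).
  - now apply is_derive_C_pair.
Qed.

Lemma is_derive_value (f : R -> R) (x a b : R) :
  is_derive f x a -> a = b -> is_derive f x b.
Proof. now intros H <-. Qed.

Lemma is_Cderive_mult (F G : R -> C) (x : R) (a b : C) :
  is_Cderive F x a -> is_Cderive G x b ->
  is_Cderive (fun r => F r * G r) x (a * G x + F x * b).
Proof.
  intros HF HG.
  pose proof (is_derive_C_fst _ _ _ HF) as F1.
  pose proof (is_derive_C_snd _ _ _ HF) as F2.
  pose proof (is_derive_C_fst _ _ _ HG) as G1.
  pose proof (is_derive_C_snd _ _ _ HG) as G2.
  apply is_Cderive_components; simpl.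
  - eapply is_derive_value.
    { apply (is_derive_minus (K := R_AbsRing)
        (fun r => (fst (F r) * fst (G r))%R) (fun r => (snd (F r) * snd (G r))%R)).
      apply (is_derive_mult (fun r => fst (F r)) (fun r => fst (G r)) x _ _ F1 G1 Rmult_comm).
      apply (is_derive_mult (fun r => snd (F r)) (fun r => snd (G r)) x _ _ F2 G2 Rmult_comm). }
    unfold minus, plus, opp, mult. simpl. ring.
  - eapply is_derive_value.
    { apply (is_derive_plus (K := R_AbsRing)
        (fun r => (fst (F r) * snd (G r))%R) (fun r => (snd (F r) * fst (G r))%R)).
      apply (is_derive_mult (fun r => fst (F r)) (fun r => snd (G r)) x _ _ F1 G2 Rmult_comm).
      apply (is_derive_mult (fun r => snd (F r)) (fun r => fst (G r)) x _ _ F2 G1 Rmult_comm). }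
    unfold minus, plus, opp, mult. simpl. ring.
Qed.

Lemma is_Cderive_inv (F : R -> C) (x : R) (a : C) :
  F x <> 0 -> is_Cderive F x a ->
  is_Cderive (fun r => / F r) x (- a * / F x * / F x).
Proof.
  intros h0 HF.
  assert (hd : (fst (F x) * (fst (F x) * 1) + snd (F x) * (snd (F x) * 1) <> 0)%R).
  { intros E. apply h0. apply injective_projections; simpl; nra. }
  pose proof (is_derive_C_fst _ _ _ HF) as F1.
  pose proof (is_derive_C_snd _ _ _ HF) as F2.
  assert (key : forall (f h : R -> R) (a b : R),
    (f x * (f x * 1) + h x * (h x * 1) <> 0)%R ->
    is_derive f x a -> is_derive h x b ->
    is_derive (fun r => f r / (f r * (f r * 1) + h r * (h r * 1)))%R x
      ((a * (h x * h x - f x * f x) - 2 * f x * h x * b)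
        / (f x * (f x * 1) + h x * (h x * 1)) ^ 2)%R).
  { intros f h c d hn hf hh.
    assert (D1 : Derive (fun r : R => f r) x = c) by exact (is_derive_unique _ _ _ hf).
    assert (D2 : Derive (fun r : R => h r) x = d) by exact (is_derive_unique _ _ _ hh).
    auto_derive; [repeat split; try exact hn; eexists; eassumption|].
    rewrite D1, D2. field. nra. }
  apply is_Cderive_components; simpl.
  - eapply is_derive_value; [exact (key _ _ _ _ hd F1 F2)|].
    cbv beta. field. nra.
  - rewrite Rplus_comm in hd.
    pose proof (is_derive_opp _ _ _ (key _ _ _ _ hd F2 F1)) as H.
    eapply is_derive_value; [eapply is_derive_ext; [|exact H]|].
    + intros t. unfold opp. simpl. unfold Rdiv.
      rewrite (Rplus_comm (snd (F t) * _)). apply Ropp_mult_distr_l.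
    + unfold opp. simpl. field. nra.
Qed.

Definition Ccontinuous (F : R -> C) (r : R) : Prop :=
  continuous (T := R_UniformSpace) (U := C_UniformSpace) F r.

Lemma Ccontinuous_fst (F : R -> C) (r : R) :
  Ccontinuous F r -> continuous (fun r => fst (F r)) r.
Proof. intros H. apply (continuous_comp F fst); [exact H | apply continuous_fst]. Qed.

Lemma Ccontinuous_snd (F : R -> C) (r : R) :
  Ccontinuous F r -> continuous (fun r => snd (F r)) r.
Proof. intros H. apply (continuous_comp F snd); [exact H | apply continuous_snd]. Qed.

Lemma Ccontinuous_components (F : R -> C) (r : R) :
  continuous (fun r => fst (F r)) r -> continuous (fun r => snd (F r)) r ->
  Ccontinuous F r.
Proof.
  intros H1 H2. unfold Ccontinuous.
  apply (continuous_ext (fun r => (fst (F r), snd (F r)) : C)).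
  - intros t. symmetry. exact (surjective_pairing (F t)).
  - apply (continuous_comp_2 (fun r => fst (F r)) (fun r => snd (F r))
      (fun a b => (a, b) : C) r H1 H2).
    apply (continuous_ext (fun t : R * R => t)); [now intros []|].
    apply continuous_id.
Qed.

Lemma Ccontinuous_mult (F G : R -> C) (r : R) :
  Ccontinuous F r -> Ccontinuous G r -> Ccontinuous (fun r => F r * G r) r.
Proof.
  intros HF HG.
  pose proof (Ccontinuous_fst _ _ HF). pose proof (Ccontinuous_snd _ _ HF).
  pose proof (Ccontinuous_fst _ _ HG). pose proof (Ccontinuous_snd _ _ HG).
  apply Ccontinuous_components; simpl.
  - apply (continuous_minus (V := R_NormedModule)
      (fun r => fst (F r) * fst (G r))%R (fun r => snd (F r) * snd (G r))%R);
      now apply (continuous_mult (K := R_AbsRing)).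
  - apply (continuous_plus (V := R_NormedModule)
      (fun r => fst (F r) * snd (G r))%R (fun r => snd (F r) * fst (G r))%R);
      now apply (continuous_mult (K := R_AbsRing)).
Qed.

Lemma Ccontinuous_const (c : C) (r : R) : Ccontinuous (fun _ => c) r.
Proof. apply continuous_const. Qed.

Lemma Ccontinuous_pow (F : R -> C) (n : nat) (r : R) :
  Ccontinuous F r -> Ccontinuous (fun r => F r ^ n) r.
Proof.
  intros H. induction n as [|n IH].
  - apply Ccontinuous_const.
  - apply (continuous_ext (fun r => F r * F r ^ n)); [reflexivity|].
    now apply Ccontinuous_mult.
Qed.

Lemma is_Cderive_continuous (F : R -> C) (r : R) (l : C) :
  is_Cderive F r l -> Ccontinuous F r.
Proof.
  intros H. apply (ex_derive_continuous (K := R_AbsRing) (V := C_R_NormedModule)).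
  now exists l.
Qed.

Definition unit_interval (r : R) : Prop := (0 <= r <= 1)%R.

Lemma Cmod_sqr_continuity (F : R -> C) (r : R) : Ccontinuous F r ->
  continuity_pt (fun r => fst (F r) ^ 2 + snd (F r) ^ 2)%R r.
Proof.
  intros H. pose proof (Ccontinuous_fst _ _ H). pose proof (Ccontinuous_snd _ _ H).
  apply continuity_pt_filterlim.
  apply (continuous_plus (V := R_NormedModule)
      (fun r => fst (F r) ^ 2)%R (fun r => snd (F r) ^ 2)%R).
  - apply (continuous_ext (fun r => fst (F r) * fst (F r))%R);
      [intros; simpl; ring|]. now apply (continuous_mult (K := R_AbsRing)).
  - apply (continuous_ext (fun r => snd (F r) * snd (F r))%R);
      [intros; simpl; ring|]. now apply (continuous_mult (K := R_AbsRing)).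
Qed.

Lemma bounded_on_continuous (F : R -> C) :
  (forall r, unit_interval r -> Ccontinuous F r) -> bounded_on unit_interval F.
Proof.
  intros H.
  destruct (continuity_ab_maj (fun r => fst (F r) ^ 2 + snd (F r) ^ 2)%R 0 1)
    as [m [hm _]]; [lra| |].
  - intros r hr. now apply Cmod_sqr_continuity, H.
  - exists (sqrt (fst (F m) ^ 2 + snd (F m) ^ 2) + 1)%R. split.
    + pose proof (sqrt_pos (fst (F m) ^ 2 + snd (F m) ^ 2)). lra.
    + intros r hr. specialize (hm r hr). unfold Cmod.
      pose proof (sqrt_le_1_alt _ _ hm). lra.
Qed.

Lemma away_from_0_continuous (F : R -> C) :
  (forall r, unit_interval r -> Ccontinuous F r) ->
  (forall r, unit_interval r -> F r <> 0) -> away_from_0 unit_interval F.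
Proof.
  intros H h0.
  destruct (continuity_ab_min (fun r => fst (F r) ^ 2 + snd (F r) ^ 2)%R 0 1)
    as [m [hm hI]]; [lra| |].
  - intros r hr. now apply Cmod_sqr_continuity, H.
  - exists (Cmod (F m)). split; [now apply Cmod_gt_0, h0|].
    intros r hr. specialize (hm r hr). unfold Cmod. now apply sqrt_le_1_alt.
Qed.

Section Contour.
Context (g : contour).

Definition is_cint (f : C -> C) (l : C) : Prop :=
  is_RInt (V := C_R_NormedModule) (fun r => f (g r) * path' g r) 0 1 l.

Lemma is_cint_unique (f : C -> C) (l : C) : is_cint f l -> contour_int f g = l.
Proof. apply (is_RInt_unique (V := C_R_CompleteNormedModule)). Qed.

Lemma is_RInt_C_ext (F G : R -> C) (l : C) :
  (forall r, unit_interval r -> F r = G r) ->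
  is_RInt (V := C_R_NormedModule) F 0 1 l ->
  is_RInt (V := C_R_NormedModule) G 0 1 l.
Proof.
  intros E. apply is_RInt_ext. intros r hr. apply E.
  rewrite Rmin_left, Rmax_right in hr by lra. unfold unit_interval. lra.
Qed.

Lemma is_cint_ext (f h : C -> C) (l : C) :
  (forall r, unit_interval r -> f (g r) = h (g r)) -> is_cint f l -> is_cint h l.
Proof. intros E. apply is_RInt_C_ext. intros r hr. now rewrite E. Qed.

Lemma is_cint_plus (f h : C -> C) (l m : C) :
  is_cint f l -> is_cint h m -> is_cint (fun z => f z + h z) (l + m).
Proof.
  intros H1 H2.
  apply (is_RInt_C_ext (fun r => f (g r) * path' g r + h (g r) * path' g r)).
  - intros; ring.
  - exact (is_RInt_plus _ _ _ _ _ _ H1 H2).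
Qed.

Lemma is_RInt_C_scal (c : C) (F : R -> C) (l : C) :
  is_RInt (V := C_R_NormedModule) F 0 1 l ->
  is_RInt (V := C_R_NormedModule) (fun r => c * F r) 0 1 (c * l).
Proof.
  intros H.
  pose proof (is_RInt_fct_extend_fst (U := R_NormedModule) (V := R_NormedModule)
    _ _ _ _ H) as H1.
  pose proof (is_RInt_fct_extend_snd (U := R_NormedModule) (V := R_NormedModule)
    _ _ _ _ H) as H2.
  apply (is_RInt_fct_extend_pair (U := R_NormedModule) (V := R_NormedModule));
    simpl.
  - exact (is_RInt_minus _ _ _ _ _ _ (is_RInt_scal _ _ _ (fst c) _ H1)
      (is_RInt_scal _ _ _ (snd c) _ H2)).
  - exact (is_RInt_plus _ _ _ _ _ _ (is_RInt_scal _ _ _ (fst c) _ H2)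
      (is_RInt_scal _ _ _ (snd c) _ H1)).
Qed.

Lemma is_cint_scal (c : C) (f : C -> C) (l : C) :
  is_cint f l -> is_cint (fun z => c * f z) (c * l).
Proof.
  intros H. apply (is_RInt_C_ext (fun r => c * (f (g r) * path' g r))).
  - intros; ring.
  - now apply is_RInt_C_scal.
Qed.

(** [F^n F'] has the primitive [F^(n+1) / (n + 1)]. *)
Lemma is_RInt_power (F F' : R -> C) (n : nat) :
  (forall r, unit_interval r -> is_Cderive F r (F' r)) ->
  (forall r, unit_interval r -> Ccontinuous F' r) -> F 0%R = F 1%R ->
  is_RInt (V := C_R_NormedModule) (fun r => F r ^ n * F' r) 0 1 (RtoC 0).
Proof.
  intros hd hc h01.
  assert (hpow : forall m r, unit_interval r ->
    is_Cderive (fun r => F r ^ S m) r (INR (S m) * (F r ^ m * F' r))).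
  { intros m r hr. induction m as [|m IH].
    - apply (is_derive_ext F); [intros; symmetry; apply Cpow_1_r|].
      replace (INR 1 * (F r ^ 0 * F' r)) with (F' r) by (simpl; ring).
      now apply hd.
    - apply (is_derive_ext (fun r => F r * F r ^ S m)); [reflexivity|].
      pose proof (is_Cderive_mult _ _ _ _ _ (hd r hr) IH) as H.
      replace (INR (S (S m)) * (F r ^ S m * F' r))
        with (F' r * F r ^ S m + F r * (INR (S m) * (F r ^ m * F' r)));
        [exact H|].
      rewrite (S_INR (S m)), RtoC_plus, !Cpow_S. ring. }
  assert (hn : RtoC (INR (S n)) <> 0) by apply RtoC_neq_0, not_0_INR, Nat.neq_succ_0.
  apply (is_RInt_C_ext
    (fun r => / INR (S n) * (INR (S n) * (F r ^ n * F' r)))).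
  { intros r hr. field. exact hn. }
  replace (RtoC 0) with (/ INR (S n) * (F 1%R ^ S n - F 0%R ^ S n))
    by (rewrite h01; ring).
  apply is_RInt_C_scal.
  apply (is_RInt_derive (V := C_R_CompleteNormedModule) (fun r => F r ^ S n)
    (fun r => INR (S n) * (F r ^ n * F' r))).
  - intros r hr. rewrite Rmin_left, Rmax_right in hr by lra. now apply hpow.
  - intros r hr. rewrite Rmin_left, Rmax_right in hr by lra.
    apply Ccontinuous_mult; [apply Ccontinuous_const|].
    apply Ccontinuous_mult; [|now apply hc].
    apply Ccontinuous_pow. apply is_Cderive_continuous with (F' r). now apply hd.
Qed.

Lemma path_Ccontinuous (r : R) : unit_interval r -> Ccontinuous g r.
Proof.
  intros hr. apply is_Cderive_continuous with (path' g r). now apply path_derive.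
Qed.

Lemma is_Cderive_path_minus (w : C) (r : R) : unit_interval r ->
  is_Cderive (fun r => g r - w) r (path' g r).
Proof.
  intros hr.
  pose proof (is_derive_minus (K := R_AbsRing) (V := C_R_NormedModule) g (fun _ => w) r
    (path' g r) zero (path_derive g r hr) (is_derive_const _ _)) as H.
  replace (path' g r) with (minus (path' g r) (zero : C_R_NormedModule)).
  - exact H.
  - apply (minus_zero_r (G := C_R_NormedModule)).
Qed.

Lemma is_cint_pow (n : nat) : is_cint (fun z => z ^ n) 0.
Proof.
  apply (is_RInt_power g (path' g) n).
  - apply path_derive.
  - apply path'_continuous.
  - apply path_closed.
Qed.

Definition avoids_minus_neq_0 (w : C) (r : R) (hw : avoids g w)
  (hr : unit_interval r) : g r - w <> 0 := Cminus_neq_0 _ _ (hw r hr).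

Lemma is_Cderive_pole (w : C) (r : R) : avoids g w -> unit_interval r ->
  is_Cderive (fun r => / (g r - w)) r (- path' g r * / (g r - w) * / (g r - w)).
Proof.
  intros hw hr. apply (is_Cderive_inv (fun r => g r - w)).
  - now apply avoids_minus_neq_0.
  - now apply is_Cderive_path_minus.
Qed.

Lemma pole_Ccontinuous (w : C) (r : R) : avoids g w -> unit_interval r ->
  Ccontinuous (fun r => / (g r - w)) r.
Proof. intros hw hr. eapply is_Cderive_continuous. now apply is_Cderive_pole. Qed.

Lemma is_cint_pole_pow (w : C) (n : nat) : avoids g w ->
  is_cint (fun z => (/ (z - w)) ^ S (S n)) 0.
Proof.
  intros hw.
  apply (is_RInt_C_ext (fun r => - (1) * ((/ (g r - w)) ^ n
    * (- path' g r * / (g r - w) * / (g r - w))))).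
  { intros r hr. rewrite !Cpow_S. ring. }
  replace (RtoC 0) with (- (1) * 0) by ring. apply is_RInt_C_scal.
  apply (is_RInt_power (fun r => / (g r - w))
    (fun r => - path' g r * / (g r - w) * / (g r - w))).
  - intros r hr. now apply is_Cderive_pole.
  - intros r hr. apply Ccontinuous_mult; [apply Ccontinuous_mult|];
      [|now apply pole_Ccontinuous..].
    apply (continuous_ext (fun r => - (1) * path' g r)).
    { intros t. change (- (1) * path' g t = - path' g t). ring. }
    apply Ccontinuous_mult; [apply Ccontinuous_const | now apply path'_continuous].
  - now rewrite path_closed.
Qed.

Lemma two_pi_i_neq_0 : 2 * PI * Ci <> 0.
Proof.
  apply Cmult_neq_0; [rewrite <- RtoC_mult; apply RtoC_neq_0; pose proof PI_RGT_0; lra|].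
  intros E. injection E. lra.
Qed.

Lemma is_cint_winding (w : C) : avoids g w ->
  is_cint (fun z => / (z - w)) (2 * PI * Ci * winding g w).
Proof.
  intros hw. unfold winding, contour_int, is_cint.
  set (I0 := RInt (V := C_R_CompleteNormedModule)
    (fun r => / (g r - w) * path' g r) 0 1).
  replace (2 * PI * Ci * (/ (2 * PI * Ci) * I0)) with I0.
  - apply (RInt_correct (V := C_R_CompleteNormedModule)).
    apply (ex_RInt_continuous (V := C_R_CompleteNormedModule)).
    intros r hr. rewrite Rmin_left, Rmax_right in hr by lra.
    apply Ccontinuous_mult; [now apply pole_Ccontinuous | now apply path'_continuous].
  - now rewrite Cmult_assoc, Cinv_r, Cmult_1_l by exact two_pi_i_neq_0.
Qed.

Lemma is_cint_rational (O : C -> Prop) (f : C -> C) :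
  (forall w, O w -> outside g w) -> rational_off O f -> is_cint f 0.
Proof.
  intros hO hf. apply rational_span in hf.
  induction hf as [n|w n hw|f h hf IHf hh IHh|c f hf IHf|f h e hf IHf].
  - apply is_cint_pow.
  - destruct (hO w hw) as [ha h0]. destruct n as [|n].
    + apply (is_cint_ext (fun z => / (z - w)));
        [intros; symmetry; apply Cpow_1_r|].
      pose proof (is_cint_winding w ha) as H. rewrite h0 in H.
      replace (RtoC 0) with (2 * PI * Ci * 0) by ring. exact H.
    + now apply is_cint_pole_pow.
  - replace (RtoC 0) with (0 + 0) by ring. now apply is_cint_plus.
  - replace (RtoC 0) with (c * 0) by ring. now apply is_cint_scal.
  - apply (is_cint_ext f); [|exact IHf]. intros r hr. apply e.
    intros hO'. apply (proj1 (hO _ hO') r hr). reflexivity.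
Qed.

(** The poles with winding number [0] may have any order. This freedom is
    needed: for [x = 1] the outer poles that depend on [x] are double. *)
Lemma residue_theorem_simple (O : C -> Prop) (f : C -> C) (V : list C) :
  (forall w, O w -> outside g w) -> rational_off O f -> NoDup V ->
  (forall v, In v V -> inside g v) ->
  is_cint (fun z => f z / Cprod (map (fun v => z - v) V))
    (2 * PI * Ci * Csum (map (simple_residue f V) V)).
Proof.
  intros hO hf hnd hV.
  assert (hVO : forall v, In v V -> ~ O v).
  { intros v hv hv'. apply hV in hv. apply hO in hv'.
    destruct hv as [_ h1]. destruct hv' as [_ h0]. rewrite h1 in h0.
    injection h0. lra. }
  destruct (partial_fractions O f V hf hnd hVO) as [h [hh E]].
  apply (is_cint_ext (fun z =>
    h z + Csum (map (fun w => simple_residue f V w / (z - w)) V))).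
  { intros r hr. symmetry. apply E; intros H.
    - exact (proj1 (hO _ H) r hr eq_refl).
    - exact (proj1 (hV _ H) r hr eq_refl). }
  rewrite <- (Cplus_0_l (2 * PI * Ci * _)). apply is_cint_plus.
  - exact (is_cint_rational O h hO hh).
  - assert (H : forall W, (forall v, In v W -> inside g v) ->
      is_cint (fun z => Csum (map (fun w => simple_residue f V w / (z - w)) W))
        (2 * PI * Ci * Csum (map (simple_residue f V) W))).
    { induction W as [|w W IH]; intros hW.
      - simpl. rewrite Cmult_0_r. apply (is_cint_ext (fun z => 0 * z ^ 0)).
        + intros; apply Cmult_0_l.
        + pose proof (is_cint_scal 0 _ _ (is_cint_pow 0)) as H0.
          rewrite Cmult_0_r in H0. exact H0.
      - cbn [map]. rewrite Csum_cons, Cmult_plus_distr_l. apply is_cint_plus.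
        + destruct (hW w (or_introl eq_refl)) as [ha h1].
          apply is_cint_winding in ha. rewrite h1 in ha.
          replace (2 * PI * Ci * simple_residue f V w)
            with (simple_residue f V w * (2 * PI * Ci * 1)) by ring.
          now apply is_cint_scal.
        + apply IH. intros; apply hW; now right. }
    now apply H.
Qed.

(** That the limit is integrable is a conclusion here, so that infinite products
    can be integrated without a study of their continuity. *)
Lemma is_cint_unif_lim (f : nat -> C -> C) (f0 : C -> C) (l : nat -> C) (l0 : C) :
  (forall n, is_cint (f n) (l n)) ->
  unif_lim unit_interval (fun n r => f n (g r)) (fun r => f0 (g r)) ->
  is_Clim l l0 -> is_cint f0 l0.
Proof.
  intros Hf Hu Hl.
  (* uniform convergence is available on [0, 1] only, and wanted on all of [R] *)
  set (cut := fun F : R -> C => fun r =>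
    if Rle_dec 0 r then if Rle_dec r 1 then F r else 0 else 0).
  assert (cutE : forall F r, unit_interval r -> cut F r = F r).
  { intros F r [h0 h1]. unfold cut. destruct (Rle_dec 0 r); [|easy].
    now destruct (Rle_dec r 1). }
  destruct (bounded_on_continuous (path' g) (path'_continuous g)) as [M [hM HM]].
  destruct (filterlim_RInt (V := C_R_CompleteNormedModule)
    (fun n => cut (fun r => f n (g r) * path' g r)) 0 1 eventually
    eventually_filter (cut (fun r => f0 (g r) * path' g r)) l) as [I0 [HI1 HI2]].
  - intros n. apply (is_RInt_C_ext (fun r => f n (g r) * path' g r)).
    + intros r hr. now rewrite cutE.
    + apply Hf.
  - intros P [eps HP]. simpl in HP.
    assert (he : (0 < eps / M)%R) by (apply Rdiv_lt_0_compat; [apply cond_pos | lra]).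
    destruct (Hu _ he) as [n0 hn]. exists n0. intros n hn'. apply HP.
    intros r. apply (C_NormedModule_mixin_compat1). change (Rlt (Cmod
      (cut (fun r => f n (g r) * path' g r) r
        - cut (fun r => f0 (g r) * path' g r) r)) eps).
    unfold cut. destruct (Rle_dec 0 r) as [h0|]; [destruct (Rle_dec r 1) as [h1|]|];
      try (unfold Cminus; rewrite Cplus_opp_r, Cmod_0; apply cond_pos).
    specialize (hn n hn' r (conj h0 h1)). specialize (HM r (conj h0 h1)).
    replace (f n (g r) * path' g r - f0 (g r) * path' g r)
      with ((f n (g r) - f0 (g r)) * path' g r) by ring.
    rewrite Cmod_mult.
    apply Rle_lt_trans with (Cmod (f n (g r) - f0 (g r)) * M)%R.
    + apply Rmult_le_compat_l; [apply Cmod_ge_0 | exact HM].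
    + apply Rmult_lt_compat_r with (r := M) in hn; [|lra].
      unfold Rdiv in hn. rewrite Rmult_assoc, Rinv_l, Rmult_1_r in hn by lra.
      exact hn.
  - replace l0 with (I0 : C).
    + apply (is_RInt_C_ext (cut (fun r => f0 (g r) * path' g r))); [|exact HI2].
      intros r hr. now rewrite cutE.
    + apply (is_Clim_unique l); [|exact Hl].
      apply is_Clim_spec. intros e he.
      assert (he' : (0 < e / 2)%R) by lra.
      destruct (HI1 (ball (I0 : C_R_NormedModule) (mkposreal _ he')))
        as [n0 hn].
      { now exists (mkposreal _ he'). }
      exists n0. intros n hn'. specialize (hn n hn').
      apply (C_NormedModule_mixin_compat2 I0 (l n) (mkposreal _ he')) in hn.
      simpl in hn. change (Cmod (l n - I0) < sqrt 2 * (e / 2))%R in hn.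
      assert (sqrt 2 < 2)%R.
      { pose proof (sqrt_lt_R0 2 ltac:(lra)). pose proof (sqrt_sqrt 2 ltac:(lra)).
        nra. }
      nra.
Qed.

End Contour.

(** * Tannery's theorem *)

Lemma Csum_app (l l' : list C) : Csum (l ++ l') = Csum l + Csum l'.
Proof.
  induction l as [|a l IH]; [symmetry; apply Cplus_0_l|].
  cbn [app]. rewrite !Csum_cons, IH. ring.
Qed.

Lemma Csum_seq_S (w : nat -> C) (m n : nat) :
  Csum (map w (seq m (S n))) = Csum (map w (seq m n)) + w (m + n)%nat.
Proof.
  rewrite seq_S, map_app, Csum_app. cbn [map]. rewrite Csum_cons. f_equal.
  apply Cplus_0_r.
Qed.

(** The sum is cut at a fixed index [K]: below [K] the limit is one of finitely
    many terms, and beyond [K] a geometric tail bounds everything. *)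
Lemma tannery (M rho : R) (T : nat -> C) (Tn : nat -> nat -> C) :
  (0 <= M)%R -> (0 < rho < 1)%R ->
  (forall k, is_Clim (fun n => Tn n k) (T k)) ->
  (forall n k, (k < n)%nat -> (Cmod (Tn n k) <= M * rho ^ k)%R) ->
  exists L, is_Clim (fun n => Csum (map T (seq 0 n))) L
    /\ is_Clim (fun n => Csum (map (Tn n) (seq 0 n))) L.
Proof.
  intros hM hr hT hb.
  assert (hTb : forall k, (Cmod (T k) <= M * rho ^ k)%R).
  { intros k. replace (T k) with (T k - 0) by ring.
    apply (is_Clim_bound_le (fun n => Tn (n + S k)%nat k)).
    - apply (is_Clim_shift (fun n => Tn n k)), hT.
    - intros n. replace (Tn (n + S k)%nat k - 0) with (Tn (n + S k)%nat k) by ring.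
      apply hb. lia. }
  destruct (geometric_cauchy (fun n => Csum (map T (seq 0 n))) M rho hM hr)
    as [L [hL hrate]].
  { intros n. rewrite Csum_seq_S, Nat.add_0_l.
    replace (Csum (map T (seq 0 n)) + T n - Csum (map T (seq 0 n))) with (T n) by ring.
    apply hTb. }
  exists L. split; [exact hL|].
  assert (htail : forall n m k, (k + m <= n)%nat ->
    (Cmod (Csum (map (Tn n) (seq k m))) <= M / (1 - rho) * (rho ^ k - rho ^ (k + m)))%R).
  { intros n m k. induction m as [|m IH]; intros hm.
    - rewrite Nat.add_0_r, Rminus_diag, Rmult_0_r. simpl. rewrite Cmod_0. lra.
    - rewrite Csum_seq_S. eapply Rle_trans; [apply Cmod_triangle|].
      eapply Rle_trans;
        [apply Rplus_le_compat; [apply IH; lia | apply hb; lia]|].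
      rewrite Nat.add_succ_r. simpl. apply Req_le. field. lra. }
  assert (hfin : forall K, is_Clim (fun n => Csum (map (Tn n) (seq 0 K)))
    (Csum (map T (seq 0 K)))).
  { induction K as [|K IH]; [exact (is_Clim_const 0)|].
    rewrite Csum_seq_S.
    apply (is_Clim_ext (fun n => Csum (map (Tn n) (seq 0 K)) + Tn n K)).
    - intros n. now rewrite Csum_seq_S.
    - now apply is_Clim_plus. }
  apply is_Clim_spec. intros e he.
  assert (hM' : (0 <= M / (1 - rho))%R) by (apply Rdiv_le_0_compat; lra).
  destruct (pow_lt_eventually (M / (1 - rho)) rho (e / 3) hM' hr) as [K hK]; [lra|].
  specialize (hK K (le_n K)).
  destruct (proj1 (is_Clim_spec _ _) (hfin K) (e / 3)%R) as [n0 hn]; [lra|].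
  exists (Nat.max n0 K). intros n hn'. specialize (hn n ltac:(lia)).
  replace n with (K + (n - K))%nat at 2 by lia.
  rewrite seq_app, map_app, Csum_app, Nat.add_0_l.
  specialize (htail n (n - K)%nat K ltac:(lia)). specialize (hrate K).
  assert (0 < rho ^ (K + (n - K)))%R by (apply pow_lt; lra).
  assert (0 <= M / (1 - rho) * rho ^ (K + (n - K)))%R by (apply Rmult_le_pos; lra).
  rewrite Rmult_minus_distr_l in htail.
  replace (Csum (map (Tn n) (seq 0 K)) + Csum (map (Tn n) (seq K (n - K))) - L)
    with ((Csum (map (Tn n) (seq 0 K)) - Csum (map T (seq 0 K)))
      + ((Csum (map T (seq 0 K)) - L) + Csum (map (Tn n) (seq K (n - K))))) by ring.
  eapply Rle_lt_trans; [apply Cmod_triangle|].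
  pose proof (Cmod_triangle (Csum (map T (seq 0 K)) - L)
    (Csum (map (Tn n) (seq K (n - K))))). lra.
Qed.

Lemma Cseries_unique (w : nat -> C) (L : C) :
  is_Clim (fun n => Csum (map w (seq 0 n))) L -> Cseries w = L.
Proof.
  intros H. apply Clim_seq_unique. apply (is_Clim_shift _ _ 1) in H.
  revert H. apply is_Clim_ext. intros n. rewrite Nat.add_1_r.
  induction n as [|n IH].
  - rewrite sum_O. simpl. apply Cplus_0_r.
  - rewrite sum_Sn, <- IH. now rewrite (Csum_seq_S w 0 (S n)).
Qed.

(** * Truncated kernels *)

Definition scale (z : C) (l : list C) : list C := map (fun a => a * z) l.

Section Kernel.
Context (p : R) (hp : (0 < p < 1)%R).
Context (nums dens : list C) (th1 th2 b1 b2 : C).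

Definition kernel (z : C) : C :=
  qpochs p (scale z nums) * (theta1 (th1 * z) p * theta1 (th2 * z) p)
  / (qpochs p (scale z dens) * (qpoch (b1 / z) p * qpoch (b2 / z) p)).

Definition trunc_kernel (n : nat) (z : C) : C :=
  qpochs_n p (scale z nums) n
  * (qpoch_n (th1 * z) p n * qpoch_n (p / (th1 * z)) p n
     * (qpoch_n (th2 * z) p n * qpoch_n (p / (th2 * z)) p n))
  / (qpochs_n p (scale z dens) n * (qpoch_n (b1 / z) p n * qpoch_n (b2 / z) p n)).

Section Lists.
Context {X : Type} (D : X -> Prop) (z : X -> C) (hz : bounded_on D z).

Lemma bounded_on_scal (a : C) : bounded_on D (fun x => a * z x).
Proof. apply bounded_on_mult; [apply bounded_on_const | exact hz]. Qed.

Lemma bounded_on_qpochs (l : list C) :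
  bounded_on D (fun x => qpochs p (scale (z x) l)).
Proof.
  induction l as [|a l IH]; [exact (bounded_on_const D 1)|].
  apply (bounded_on_mult D (fun x => qpoch (a * z x) p)); [|exact IH].
  apply bounded_on_qpoch; [exact hp | apply bounded_on_scal].
Qed.

Lemma unif_lim_qpochs (l : list C) :
  unif_lim D (fun n x => qpochs_n p (scale (z x) l) n)
    (fun x => qpochs p (scale (z x) l)).
Proof.
  induction l as [|a l IH]; [exact (unif_lim_const D (fun _ => RtoC 1))|].
  apply (unif_lim_mult D (fun n x => qpoch_n (a * z x) p n)
    (fun n x => qpochs_n p (scale (z x) l) n) (fun x => qpoch (a * z x) p)).
  - apply bounded_on_qpoch; [exact hp | apply bounded_on_scal].
  - apply bounded_on_qpochs.
  - apply unif_lim_qpoch; [exact hp | apply bounded_on_scal].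
  - exact IH.
Qed.

Lemma away_from_0_qpochs (l : list C) :
  (forall a, In a l -> forall k, away_from_0 D (fun x => 1 - a * z x * (p ^ k)%R)) ->
  away_from_0 D (fun x => qpochs p (scale (z x) l)).
Proof.
  induction l as [|a l IH]; intros h.
  - apply (away_from_0_const D 1), RtoC_neq_0. lra.
  - apply (away_from_0_mult D (fun x => qpoch (a * z x) p)).
    + apply away_from_0_qpoch; [exact hp | apply bounded_on_scal|].
      apply h. now left.
    + apply IH. intros b hb. apply h. now right.
Qed.

End Lists.

Lemma unif_lim_kernel {X : Type} (D : X -> Prop) (z : X -> C) :
  bounded_on D z -> away_from_0 D z -> th1 <> 0 -> th2 <> 0 ->
  (forall a, In a dens -> forall k,
    away_from_0 D (fun x => 1 - a * z x * (p ^ k)%R)) ->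
  (forall k, away_from_0 D (fun x => 1 - b1 / z x * (p ^ k)%R)) ->
  (forall k, away_from_0 D (fun x => 1 - b2 / z x * (p ^ k)%R)) ->
  unif_lim D (fun n x => trunc_kernel n (z x) / z x) (fun x => kernel (z x) / z x).
Proof.
  intros hz h0 h1 h2 ha hb1 hb2.
  assert (hzi : bounded_on D (fun x => / z x)) by now apply bounded_on_inv.
  assert (hb : forall c, bounded_on D (fun x => c / z x)).
  { intros c. apply (bounded_on_mult D (fun _ => c)); [apply bounded_on_const|exact hzi]. }
  assert (hth : forall c : C, c <> 0 -> bounded_on D (fun x => p / (c * z x))).
  { intros c hc. apply (bounded_on_mult D (fun _ => RtoC p)); [apply bounded_on_const|].
    apply (bounded_on_inv D (fun x => c * z x)).
    apply (away_from_0_mult D (fun _ => c)); [now apply away_from_0_const | exact h0]. }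
  assert (T : forall c : C, c <> 0 ->
    bounded_on D (fun x => theta1 (c * z x) p) /\
    unif_lim D (fun n x => qpoch_n (c * z x) p n * qpoch_n (p / (c * z x)) p n)
      (fun x => theta1 (c * z x) p)).
  { intros c hc. pose proof (bounded_on_scal D z hz c) as hcz.
    specialize (hth c hc). split.
    - apply (bounded_on_mult D (fun x => qpoch (c * z x) p)); now apply bounded_on_qpoch.
    - apply (unif_lim_mult D (fun n x => qpoch_n (c * z x) p n)
        (fun n x => qpoch_n (p / (c * z x)) p n) (fun x => qpoch (c * z x) p));
        try (now apply bounded_on_qpoch); now apply unif_lim_qpoch. }
  destruct (T th1 h1) as [T1b T1]. destruct (T th2 h2) as [T2b T2].
  assert (hbb1 := bounded_on_qpoch p hp D _ (hb b1)).
  assert (hbb2 := bounded_on_qpoch p hp D _ (hb b2)).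
  assert (hden : away_from_0 D (fun x =>
    qpochs p (scale (z x) dens) * (qpoch (b1 / z x) p * qpoch (b2 / z x) p))).
  { apply away_from_0_mult; [now apply away_from_0_qpochs|].
    apply away_from_0_mult; now apply away_from_0_qpoch. }
  apply (unif_lim_mult D (fun n x => trunc_kernel n (z x)) (fun n x => / z x)
    (fun x => kernel (z x)) (fun x => / z x)); [|exact hzi| |apply unif_lim_const].
  - apply bounded_on_mult; [|now apply bounded_on_inv].
    apply bounded_on_mult; [now apply bounded_on_qpochs|].
    now apply bounded_on_mult.
  - apply (unif_lim_mult D
      (fun n x => qpochs_n p (scale (z x) nums) n
        * (qpoch_n (th1 * z x) p n * qpoch_n (p / (th1 * z x)) p n
        * (qpoch_n (th2 * z x) p n * qpoch_n (p / (th2 * z x)) p n)))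
      (fun n x => / (qpochs_n p (scale (z x) dens) n
        * (qpoch_n (b1 / z x) p n * qpoch_n (b2 / z x) p n)))).
    + apply bounded_on_mult; [now apply bounded_on_qpochs|].
      now apply bounded_on_mult.
    + now apply bounded_on_inv.
    + apply unif_lim_mult; [now apply bounded_on_qpochs | now apply bounded_on_mult
        | now apply unif_lim_qpochs|].
      now apply unif_lim_mult.
    + apply unif_lim_inv; [exact hden|].
      apply unif_lim_mult; [now apply bounded_on_qpochs | now apply bounded_on_mult
        | now apply unif_lim_qpochs|].
      apply unif_lim_mult; [exact hbb1 | exact hbb2 | |]; now apply unif_lim_qpoch.
Qed.

End Kernel.

(** * Residues of the truncated kernels *)

Lemma Cprod_app (l l' : list C) : Cprod (l ++ l') = Cprod l * Cprod l'.
Proof.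
  induction l as [|a l IH]; [symmetry; apply Cmult_1_l|].
  cbn [app]. rewrite !Cprod_cons, IH. ring.
Qed.

Lemma Cprod_seq_S (w : nat -> C) (m n : nat) :
  Cprod (map w (seq m (S n))) = Cprod (map w (seq m n)) * w (m + n)%nat.
Proof.
  rewrite seq_S, map_app, Cprod_app. cbn [map]. rewrite Cprod_cons. f_equal.
  apply Cmult_1_r.
Qed.

Section Residues.
Context (p : R) (hp : (0 < p < 1)%R).

Definition qpoints (b : C) (n : nat) : list C :=
  map (fun k => b * (p ^ k)%R) (seq 0 n).

Lemma In_qpoints (b z : C) (n : nat) :
  In z (qpoints b n) -> exists k, (k < n)%nat /\ z = b * (p ^ k)%R.
Proof.
  intros h. apply in_map_iff in h. destruct h as [k [<- hk]].
  apply in_seq in hk. exists k. split; [lia | reflexivity].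
Qed.

Lemma Cprod_seq_qpoch (b z : C) (m n : nat) : z <> 0 ->
  Cprod (map (fun k => z - b * (p ^ k)%R) (seq m n))
  = z ^ n * qpoch_n (b * (p ^ m)%R / z) p n.
Proof.
  intros hz. induction n as [|n IH]; [simpl; symmetry; apply Cmult_1_l|].
  rewrite Cprod_seq_S, IH. cbn [qpoch_n].
  rewrite Cpow_S, pow_add, RtoC_mult. field. exact hz.
Qed.

Lemma Cprod_qpoints (b z : C) (n : nat) : z <> 0 ->
  Cprod (map (fun v => z - v) (qpoints b n)) = z ^ n * qpoch_n (b / z) p n.
Proof.
  intros hz. unfold qpoints. rewrite map_map, Cprod_seq_qpoch by exact hz.
  simpl. now rewrite Cmult_1_r.
Qed.

Lemma Cprod_qpoints_0 (b : C) (n : nat) :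
  Cprod (map (fun v => 0 - v) (qpoints b n)) = (- b) ^ n * ptri p n.
Proof.
  unfold qpoints. rewrite map_map.
  induction n as [|n IH]; [simpl; symmetry; apply Cmult_1_l|].
  rewrite Cprod_seq_S, IH, Cpow_S. cbn [ptri]. simpl (0 + n)%nat. ring.
Qed.

Lemma pow_p_inj (j k : nat) : (p ^ j)%R = (p ^ k)%R -> j = k.
Proof.
  assert (H : forall j k, (j < k)%nat -> (p ^ k < p ^ j)%R).
  { intros i m hi. replace m with (i + S (m - S i))%nat by lia.
    rewrite pow_add. pose proof (pow_p_pos p hp i).
    pose proof (pow_p_pos p hp (m - S i)). pose proof (pow_p_le_1 p hp (m - S i)).
    simpl. assert (p * p ^ (m - S i) < 1)%R by nra. nra. }
  intros E. destruct (Nat.lt_trichotomy j k) as [h|[h|h]]; [|exact h|];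
    specialize (H _ _ h); lra.
Qed.

Lemma qpoints_inj (b : C) (j k : nat) : b <> 0 ->
  b * (p ^ j)%R = b * (p ^ k)%R -> j = k.
Proof.
  intros hb E. apply pow_p_inj.
  assert (h : RtoC (p ^ j) = RtoC (p ^ k)).
  { transitivity (b * (p ^ j)%R / b); [field; exact hb|].
    rewrite E. field. exact hb. }
  exact (f_equal fst h).
Qed.

Lemma NoDup_qpoints (b : C) (n : nat) : b <> 0 -> NoDup (qpoints b n).
Proof.
  intros hb. apply NoDup_map_NoDup_ForallPairs; [|apply seq_NoDup].
  intros j k _ _. now apply qpoints_inj.
Qed.

(** Of the factors [b p^k - b p^j] those with [j < k] give [(p^(-k); p)_k] and
    those with [j > k] give [(p; p)_(n - k - 1)]. *)
Lemma Cprod_punctured_qpoints (b : C) (k m : nat) : b <> 0 ->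
  let w := b * (p ^ k)%R in
  Cprod (map (punctured w) (qpoints b (k + S m)))
  = w ^ (k + m) * (qpoch_n (p / (p * (p ^ k)%R)) p k * qpoch_n p p m).
Proof.
  intros hb w.
  assert (hw : w <> 0) by (apply Cmult_neq_0; [exact hb | now apply pow_p_neq_0]).
  assert (hne : forall j, j <> k -> w <> b * (p ^ j)%R).
  { intros j hj E. apply hj. symmetry. now apply (qpoints_inj b). }
  pose proof (pow_p_neq_0 p hp k). pose proof (RtoC_neq_0 p ltac:(lra)).
  unfold qpoints. rewrite map_map, seq_app, map_app, Cprod_app.
  cbn [seq map]. rewrite Cprod_cons. simpl (0 + k)%nat.
  fold w. rewrite punctured_eq.
  rewrite (map_ext_in _ (fun j => w - b * (p ^ j)%R)),
    (map_ext_in (fun j => punctured w _) (fun j => w - b * (p ^ j)%R)).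
  - rewrite !Cprod_seq_qpoch by exact hw.
    replace (b * (p ^ 0)%R / w) with (p / (p * (p ^ k)%R)).
    replace (b * (p ^ S k)%R / w) with (RtoC p).
    + rewrite Cpow_add_r. ring.
    + unfold w. simpl (p ^ S k)%R. rewrite RtoC_mult. field. auto.
    + unfold w. simpl (p ^ 0)%R. field. auto.
  - intros j hj. apply in_seq in hj. apply punctured_neq, hne. lia.
  - intros j hj. apply in_seq in hj. apply punctured_neq, hne. lia.
Qed.

Context (nums dens : list C) (th1 th2 b1 b2 : C).

(** The numerator that is left when the poles of [trunc_kernel n z / z] at the
    origin and at the points of the two progressions are split off. *)
Definition regular_part (n : nat) (z : C) : C :=
  qpochs_n p (scale z nums) n * (qpoch_n (th1 * z) p n * qpoch_n (th2 * z) p n)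
  * (Cprod (map (fun v => z - v) (qpoints (p / th1) n))
     * Cprod (map (fun v => z - v) (qpoints (p / th2) n)))
  / qpochs_n p (scale z dens) n.

Definition inner_poles (n : nat) : list C := RtoC 0 :: qpoints b1 n ++ qpoints b2 n.

Definition outer_pole (w : C) : Prop :=
  exists a k, In a dens /\ w = / (a * (p ^ k)%R).

Lemma trunc_kernel_split (n : nat) (z : C) : z <> 0 -> th1 <> 0 -> th2 <> 0 ->
  trunc_kernel p nums dens th1 th2 b1 b2 n z / z
  = regular_part n z / Cprod (map (fun v => z - v) (inner_poles n)).
Proof.
  intros hz h1 h2. unfold trunc_kernel, regular_part, inner_poles.
  cbn [map]. rewrite map_app, Cprod_cons, Cprod_app, !Cprod_qpoints by exact hz.
  replace (p / th1 / z) with (p / (th1 * z)) by (field; now split).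
  replace (p / th2 / z) with (p / (th2 * z)) by (field; now split).
  unfold Cdiv. rewrite !Cinv_mult.
  assert (hzn : z ^ n <> 0) by now apply Cpow_nz.
  replace (z - 0) with z by ring.
  repeat match goal with |- context [/ qpoch_n ?a ?r ?m] =>
    generalize (/ qpoch_n a r m) end.
  generalize (/ qpochs_n p (scale z dens) n). intros. field. now split.
Qed.

Lemma rational_qpoch_n (O : C -> Prop) (a : C) (n : nat) :
  rational_off O (fun z => qpoch_n (a * z) p n).
Proof.
  induction n as [|n IH]; [apply (rational_const O 1)|].
  apply (rational_mult O (fun z => qpoch_n (a * z) p n)
    (fun z => 1 - a * z * (p ^ n)%R) IH).
  apply (rational_ext O (fun z => 1 + - (a * (p ^ n)%R) * z)); [intros; ring|].
  apply rational_plus; [apply rational_const|].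
  apply rational_mult; [apply rational_const | apply rational_id].
Qed.

Lemma rational_inv_qpoch_n (O : C -> Prop) (a : C) (n : nat) : a <> 0 ->
  (forall k, O (/ (a * (p ^ k)%R))) ->
  rational_off O (fun z => / qpoch_n (a * z) p n).
Proof.
  intros ha hO. induction n as [|n IH].
  - apply (rational_ext O (fun z => 1)); [|apply (rational_const O 1)].
    intros z hz. simpl. field. 
  - apply (rational_ext O (fun z => / qpoch_n (a * z) p n
      * (- / (a * (p ^ n)%R) * / (z - / (a * (p ^ n)%R))))).
    + intros z hz. cbn [qpoch_n]. rewrite (Cinv_mult (qpoch_n _ _ _)). f_equal.
      pose proof (pow_p_neq_0 p hp n).
      assert (hza : z - / (a * (p ^ n)%R) <> 0).
      { apply Cminus_neq_0. intros ->. apply hz, hO. }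
      assert (hq : 1 - a * z * (p ^ n)%R <> 0).
      { intros E. apply hza. replace (z - / (a * (p ^ n)%R))
          with (- (1 - a * z * (p ^ n)%R) / (a * (p ^ n)%R)) by (field; auto).
        rewrite E. field. auto. }
      replace (z - / (a * (p ^ n)%R))
        with (- (1 - a * z * (p ^ n)%R) / (a * (p ^ n)%R)) by (field; auto).
      field. auto.
    + apply rational_mult; [exact IH|].
      apply rational_mult; [apply rational_const | apply rational_pole, hO].
Qed.

Lemma rational_qpochs_n (O : C -> Prop) (l : list C) (n : nat) :
  rational_off O (fun z => qpochs_n p (scale z l) n).
Proof.
  induction l as [|a l IH]; [apply (rational_const O 1)|].
  exact (rational_mult O _ _ (rational_qpoch_n O a n) IH).
Qed.

Lemma rational_inv_qpochs_n (O : C -> Prop) (l : list C) (n : nat) :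
  (forall a, In a l -> a <> 0) ->
  (forall a k, In a l -> O (/ (a * (p ^ k)%R))) ->
  rational_off O (fun z => / qpochs_n p (scale z l) n).
Proof.
  intros h0 hO. induction l as [|a l IH].
  - apply (rational_ext O (fun z => 1)); [|apply (rational_const O 1)].
    intros z hz. unfold qpochs_n, Cprod. simpl. field.
  - apply (rational_ext O (fun z => / qpoch_n (a * z) p n
      * / qpochs_n p (scale z l) n)).
    + intros z hz. rewrite <- Cinv_mult. reflexivity.
    + apply rational_mult.
      * apply rational_inv_qpoch_n; [apply h0; now left|].
        intros k. apply hO. now left.
      * apply IH; intros; [apply h0 | apply hO]; now right.
Qed.

Lemma rational_root_product (O : C -> Prop) (V : list C) :
  rational_off O (fun z => Cprod (map (fun v => z - v) V)).
Proof.
  induction V as [|v V IH]; [apply (rational_const O 1)|].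
  apply (rational_mult O (fun z => z - v)); [|exact IH].
  apply (rational_plus O (fun z => z) (fun _ => - v));
    [apply rational_id | apply rational_const].
Qed.

Lemma rational_regular_part (n : nat) : (forall a, In a dens -> a <> 0) ->
  rational_off outer_pole (regular_part n).
Proof.
  intros h0.
  apply (rational_mult outer_pole (fun z =>
    qpochs_n p (scale z nums) n * (qpoch_n (th1 * z) p n * qpoch_n (th2 * z) p n)
    * (Cprod (map (fun v => z - v) (qpoints (p / th1) n))
     * Cprod (map (fun v => z - v) (qpoints (p / th2) n))))
    (fun z => / qpochs_n p (scale z dens) n)).
  - apply rational_mult; [apply rational_mult|]; [apply rational_qpochs_n| |].
    + apply rational_mult; apply rational_qpoch_n.
    + apply rational_mult; apply rational_root_product.
  - apply rational_inv_qpochs_n; [exact h0|]. intros a k ha. now exists a, k.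
Qed.

Lemma qpochs_n_scale_0 (l : list C) (n : nat) : qpochs_n p (scale 0 l) n = 1.
Proof.
  assert (H : forall a, qpoch_n (a * 0) p n = 1).
  { intros a. rewrite Cmult_0_r. induction n as [|n IH]; [reflexivity|].
    cbn [qpoch_n]. rewrite IH. ring. }
  induction l as [|a l IH]; [reflexivity|].
  unfold qpochs_n in *. cbn [scale map]. rewrite Cprod_cons.
  change (map (fun a0 => a0 * 0) l) with (scale 0 l).
  rewrite IH, H. ring.
Qed.

End Residues.

Lemma Copp_inv_neq_0 (c : C) : c <> 0 -> - / c <> 0.
Proof.
  intros hc E. apply (RtoC_neq_0 1 ltac:(lra)).
  replace (RtoC 1) with (- (- / c * c)) by (field; auto). rewrite E. ring.
Qed.

Section ResidueValues.
Context (p : R) (hp : (0 < p < 1)%R) (nums dens : list C) (th1 th2 : C).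
Context (hth1 : th1 <> 0) (hth2 : th2 <> 0).

Definition trunc_residue (b b' : C) (n k : nat) : C :=
  (p ^ k)%R * (qpochs_n p (scale (b * (p ^ k)%R) nums) n
    * (qpoch_n (th1 * b) p (k + n) * qpoch_n (p / (th1 * b)) p (n - k)
       * (qpoch_n (th2 * b) p (k + n) * qpoch_n (p / (th2 * b)) p (n - k))))
  / (qpochs_n p (scale (b * (p ^ k)%R) dens) n
    * (qpoch_n p p k * qpoch_n (p * b / b') p k
       * (qpoch_n (b' / b) p (n - k) * qpoch_n p p (n - S k)))).

(** At the point [b p^k] the factorials of [p / (th1 z)], [p / (th2 z)], [b / z]
    and [b' / z] contain negative powers of [p], and the offending part of each is
    reversed by [qpoch_n_reverse]. The resulting monomials combine to
    [(p^2 / (th1 th2 b b'))^k], which is [p^k]: this is why the residues form a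
    series of argument [p]. *)
Lemma simple_residue_at_qpoint (b b' : C) (n k : nat) : (k < n)%nat ->
  b <> 0 -> b' <> 0 -> th1 * th2 * b * b' = p ->
  (forall i j, b * (p ^ i)%R <> b' * (p ^ j)%R) ->
  let w := b * (p ^ k)%R in
  regular_part p nums dens th1 th2 n w
    / (w * (Cprod (map (punctured w) (qpoints p b n))
       * Cprod (map (punctured w) (qpoints p b' n))))
  = trunc_residue b b' n k.
Proof.
  intros hk hb hb' hbal hne w.
  pose proof (pow_p_neq_0 p hp k) as hpk.
  pose proof (RtoC_neq_0 p ltac:(lra)) as hp0.
  pose proof (ptri_neq_0 p hp k) as htk.
  assert (hw : w <> 0) by now apply Cmult_neq_0.
  unfold regular_part, trunc_residue. fold w.
  rewrite (Cprod_punctured (qpoints p b' n)).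
  2: { intros H. apply In_qpoints in H. destruct H as [j [_ E]]. now apply (hne k j). }
  rewrite !Cprod_qpoints by exact hw.
  replace n with (k + S (n - S k))%nat by lia.
  set (m := (n - S k)%nat).
  replace (k + S m - k)%nat with (S m) by lia.
  replace (k + S m - S k)%nat with m by lia.
  pose proof (Cprod_punctured_qpoints p hp b k m hb) as Hp.
  cbv zeta in Hp. fold w in Hp. rewrite Hp. clear Hp.
  replace (p / th1 / w) with (p / (th1 * b * (p ^ k)%R))
    by (unfold w; field; auto).
  replace (p / th2 / w) with (p / (th2 * b * (p ^ k)%R))
    by (unfold w; field; auto).
  replace (b' / w) with (p / (p * b / b' * (p ^ k)%R))
    by (unfold w; field; auto).
  rewrite (qpoch_n_reverse p hp p k hp0).
  assert (hu : p * b / b' <> 0).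
  { intros E. apply (Cmult_neq_0 _ _ hp0 hb).
    replace (p * b) with (p * b / b' * b') by (field; auto). rewrite E. ring. }
  rewrite (qpoch_n_reverse_add p hp (p * b / b') k (S m) hu).
  rewrite !qpoch_n_reverse_add by (try exact hp; now apply Cmult_neq_0).
  replace (p / (p * b / b')) with (b' / b) by (field; auto).
  rewrite !(qpoch_n_add p _ k (k + S m)).
  replace (th1 * b * (p ^ k)%R) with (th1 * w) by (unfold w; ring).
  replace (th2 * b * (p ^ k)%R) with (th2 * w) by (unfold w; ring).
  (* [th1 th2 b b' = p] enters here, through the monomials of the reversals. *)
  replace ((- / (th1 * b)) ^ k) with ((- / (p * b / b')) ^ k * (- / p) ^ k * (p ^ k)%R
    / (- / (th2 * b)) ^ k).
  2: { rewrite RtoC_pow, <- !Cpow_mult_l. unfold Cdiv.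
    rewrite <- Cpow_inv, <- Cpow_mult_l by now apply Copp_inv_neq_0, Cmult_neq_0.
    f_equal. field_simplify_eq; [|now auto].
    rewrite <- hbal. ring. }
  assert (hnz : forall c : C, c <> 0 -> (- / c) ^ k <> 0).
  { intros c hc. now apply Cpow_nz, Copp_inv_neq_0. }
  pose proof (hnz p hp0) as n1. pose proof (hnz _ hu) as n2.
  pose proof (hnz _ (Cmult_neq_0 _ _ hth2 hb)) as n3. clear hnz.
  revert n1 n2 n3. generalize ((- / p) ^ k) ((- / (p * b / b')) ^ k) ((- / (th2 * b)) ^ k).
  intros e1 e2 e3 n1 n2 n3.
  rewrite !Cpow_add_r, Cpow_S.
  assert (hwk : w ^ k <> 0) by now apply Cpow_nz.
  assert (hwm : w ^ m <> 0) by now apply Cpow_nz.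
  unfold Cdiv. rewrite !Cinv_mult.
  repeat match goal with |- context [/ qpoch_n ?a ?r ?j] =>
    generalize (/ qpoch_n a r j) end.
  generalize (/ qpochs_n p (scale w dens) (k + S m)).
  revert hwk hwm. generalize (w ^ k) (w ^ m). intros. clearbody w. field.
  repeat split; auto.
Qed.

(** In the variable [1 / z] the numerator and the denominator of the truncated
    kernel have the same degree. The kernel thus has the finite value
    [(p^2 / (th1 th2 b b'))^n = p^n] at the origin, where the poles of the full
    kernel accumulate. *)
Lemma simple_residue_at_0 (b b' : C) (n : nat) :
  b <> 0 -> b' <> 0 -> th1 * th2 * b * b' = p ->
  simple_residue (regular_part p nums dens th1 th2 n) (inner_poles p b b' n) 0
  = (p ^ n)%R.
Proof.
  intros hb hb' hbal.
  assert (hin : forall c : C, c <> 0 -> ~ In (RtoC 0) (qpoints p c n)).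
  { intros c hc H. apply In_qpoints in H. destruct H as [j [_ E]].
    symmetry in E. revert E. apply Cmult_neq_0; [exact hc | now apply pow_p_neq_0]. }
  pose proof (ptri_neq_0 p hp n) as ht.
  pose proof (RtoC_neq_0 p ltac:(lra)) as hp0.
  unfold simple_residue, inner_poles, regular_part.
  cbn [map]. rewrite map_app, Cprod_cons, Cprod_app, punctured_eq.
  rewrite !Cprod_punctured, !Cprod_qpoints_0, !qpochs_n_scale_0 by auto.
  assert (H : forall a, qpoch_n (a * 0) p n = 1).
  { intros a. pose proof (qpochs_n_scale_0 p [a] n) as E.
    unfold qpochs_n in E. cbn [scale map] in E. rewrite Cprod_cons in E.
    rewrite <- E. symmetry. apply Cmult_1_r. }
  rewrite !H.
  replace ((p ^ n)%R : C) with ((- (p / th1)) ^ n * (- (p / th2)) ^ n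
    / ((- b) ^ n * (- b') ^ n)).
  - assert (hnz : forall c : C, c <> 0 -> (- c) ^ n <> 0).
    { intros c hc. apply Cpow_nz. intros E. apply hc.
      replace c with (- - c) by ring. rewrite E. ring. }
    pose proof (hnz b hb). pose proof (hnz b' hb'). field. auto.
  - rewrite RtoC_pow, <- !Cpow_mult_l. unfold Cdiv.
    assert (hbb : - b * - b' <> 0).
    { replace (- b * - b') with (b * b') by ring. now apply Cmult_neq_0. }
    rewrite <- Cpow_inv, <- Cpow_mult_l by exact hbb. f_equal.
    field_simplify_eq; [|now auto]. rewrite <- hbal. ring.
Qed.

End ResidueValues.

(** * The contour integral of the kernel *)

Lemma away_from_0_ext {X} (D : X -> Prop) (l m : X -> C) :
  (forall x, D x -> l x = m x) -> away_from_0 D l -> away_from_0 D m.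
Proof.
  intros E [d [hd H]]. exists d. split; [exact hd|]. intros x hx.
  rewrite <- E by exact hx. now apply H.
Qed.

Section Residues.
Context (p : R) (hp : (0 < p < 1)%R) (nums dens : list C) (th1 th2 : C).

Lemma is_Clim_qpochs (z : C) (l : list C) :
  is_Clim (fun n => qpochs_n p (scale z l) n) (qpochs p (scale z l)).
Proof.
  apply (unif_lim_qpochs p hp (fun _ : unit => True) (fun _ => z)).
  apply bounded_on_const.
Qed.

Lemma qpochs_neq_0 (z : C) (l : list C) :
  (forall a, In a l -> forall k, 1 - a * z * (p ^ k)%R <> 0) ->
  qpochs p (scale z l) <> 0.
Proof.
  intros h. apply Cprod_neq_0. intros c hc. unfold scale in hc.
  rewrite map_map in hc. apply in_map_iff in hc. destruct hc as [a [<- ha]].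
  now apply qpoch_neq_0, h.
Qed.

Lemma qpochs_split (z : C) (l : list C) (k : nat) :
  qpochs p (scale z l)
  = qpochs_n p (scale z l) k * qpochs p (scale (z * (p ^ k)%R) l).
Proof.
  induction l as [|a l IH]; [symmetry; apply Cmult_1_l|].
  unfold qpochs, qpochs_n in *. cbn [scale map]. rewrite !Cprod_cons.
  fold (scale z l). fold (scale (z * (p ^ k)%R) l).
  rewrite IH, (qpoch_split p hp (a * z) k), !Cmult_assoc. ring.
Qed.

Section Pair.
Context (b b' : C) (hb : b <> 0) (hb' : b' <> 0).
Context (hne : forall i j, b * (p ^ i)%R <> b' * (p ^ j)%R).
Context (haz : forall a, In a dens -> forall k, 1 - a * b * (p ^ k)%R <> 0).

Lemma ratio_factor_neq_0 (k : nat) : 1 - b' / b * (p ^ k)%R <> 0.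
Proof.
  intros E. apply (hne 0 k). simpl (p ^ 0)%R.
  transitivity (b * (1 - b' / b * (p ^ k)%R) + b' * (p ^ k)%R);
    [field; exact hb|]. rewrite E. ring.
Qed.

Lemma ratio_factor_neq_0' (k : nat) : 1 - p * b / b' * (p ^ k)%R <> 0.
Proof.
  intros E. apply (hne (S k) 0). simpl (p ^ S k)%R. simpl (p ^ 0)%R.
  rewrite RtoC_mult.
  transitivity (b' - b' * (1 - p * b / b' * (p ^ k)%R)); [field; exact hb'|].
  rewrite E. ring.
Qed.

Lemma p_factor_neq_0 (k : nat) : 1 - p * (p ^ k)%R <> 0.
Proof.
  rewrite <- RtoC_mult, <- RtoC_minus. apply RtoC_neq_0.
  pose proof (pow_p_le_1 p hp k). pose proof (pow_p_pos p hp k). nra.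
Qed.

Definition residue_limit (k : nat) : C :=
  (p ^ k)%R * (qpochs p (scale (b * (p ^ k)%R) nums)
    * (theta1 (th1 * b) p * theta1 (th2 * b) p))
  / (qpochs p (scale (b * (p ^ k)%R) dens)
    * (qpoch_n p p k * qpoch_n (p * b / b') p k
       * (qpoch (b' / b) p * qpoch p p))).

Lemma dens_shift_neq_0 (k : nat) :
  qpochs p (scale (b * (p ^ k)%R) dens) <> 0.
Proof.
  apply qpochs_neq_0. intros a ha j E. apply (haz a ha (k + j)).
  rewrite <- E, pow_add, RtoC_mult. ring.
Qed.

Lemma is_Clim_trunc_residue (k : nat) :
  is_Clim (fun n => trunc_residue p nums dens th1 th2 b b' n k) (residue_limit k).
Proof.
  assert (hth : forall c, is_Clim
    (fun n => qpoch_n c p (k + n) * qpoch_n (p / c) p (n - k)) (theta1 c p)).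
  { intros c. apply is_Clim_mult.
    - apply (is_Clim_ext (fun n => qpoch_n c p (n + k))).
      + intros n. now rewrite Nat.add_comm.
      + apply (is_Clim_shift (qpoch_n c p)). now apply is_Clim_qpoch.
    - apply (is_Clim_sub (qpoch_n (p / c) p)). now apply is_Clim_qpoch. }
  apply is_Clim_mult.
  - apply is_Clim_mult; [apply is_Clim_const|].
    apply is_Clim_mult; [apply is_Clim_qpochs|]. apply is_Clim_mult; apply hth.
  - apply is_Clim_inv.
    + repeat apply Cmult_neq_0; [apply dens_shift_neq_0 | | | |].
      * apply qpoch_n_neq_0, p_factor_neq_0.
      * apply qpoch_n_neq_0, ratio_factor_neq_0'.
      * apply qpoch_neq_0; [exact hp | apply ratio_factor_neq_0].
      * apply qpoch_neq_0; [exact hp | apply p_factor_neq_0].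
    + apply is_Clim_mult; [apply is_Clim_qpochs|].
      apply is_Clim_mult; [apply is_Clim_const|]. apply is_Clim_mult.
      * apply (is_Clim_sub (qpoch_n (b' / b) p)). now apply is_Clim_qpoch.
      * apply (is_Clim_sub (qpoch_n p p)). now apply is_Clim_qpoch.
Qed.

(** All truncated products that occur are bounded and the denominators stay
    away from [0], uniformly in [n] and [k]; only [p^k] is left. *)
Lemma trunc_residue_bound : exists M : R, (0 <= M)%R /\ forall n k,
  (Cmod (trunc_residue p nums dens th1 th2 b b' n k) <= M * p ^ k)%R.
Proof.
  set (D := fun _ : nat * nat => True).
  assert (Bq : forall (c : C) (m : nat * nat -> nat),
    bounded_on D (fun x => qpoch_n c p (m x))).
  { intros c m. destruct (qpoch_n_bound p hp (Cmod c) (Cmod_ge_0 c)) as [M [hM H]].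
    exists M. split; [exact hM|]. intros x _. apply H, Rle_refl. }
  assert (Bs : forall l, bounded_on D
    (fun x => qpochs_n p (scale (b * (p ^ snd x)%R) l) (fst x))).
  { induction l as [|a l IH]; [exact (bounded_on_const D 1)|].
    apply (bounded_on_mult D
      (fun x => qpoch_n (a * (b * (p ^ snd x)%R)) p (fst x))); [|exact IH].
    destruct (qpoch_n_bound p hp (Cmod (a * b)) (Cmod_ge_0 _)) as [M [hM H]].
    exists M. split; [exact hM|]. intros x _. apply H.
    rewrite Cmult_assoc. now apply Cmod_mult_pow_p_le. }
  assert (Aq : forall (c : C) (m : nat * nat -> nat),
    (forall k, 1 - c * (p ^ k)%R <> 0) ->
    away_from_0 D (fun x => qpoch_n c p (m x))).
  { intros c m hc. destruct (qpoch_n_lower p hp c hc) as [d [hd H]].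
    exists d. split; [exact hd|]. intros x _. apply H. }
  assert (nums' : away_from_0 D
    (fun x => qpochs_n p (scale (b * (p ^ snd x)%R) dens) (fst x))).
  { clear - hp haz Aq Bq. induction dens as [|a l IH].
    - apply (away_from_0_const D 1), RtoC_neq_0. lra.
    - apply (away_from_0_mult D
        (fun x => qpoch_n (a * (b * (p ^ snd x)%R)) p (fst x))).
      + assert (hab : forall k, 1 - a * b * (p ^ k)%R <> 0)
          by (apply haz; now left).
        apply (away_from_0_ext D (fun x => qpoch_n (a * b) p (snd x + fst x)
          * / qpoch_n (a * b) p (snd x))).
        * intros x _. rewrite qpoch_n_add, Cmult_assoc. field.
          now apply qpoch_n_neq_0.
        * apply away_from_0_mult; [now apply Aq|]. apply away_from_0_inv.
          -- apply Bq.
          -- intros x _. now apply qpoch_n_neq_0.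
      + apply IH. intros c hc. apply haz. now right. }
  assert (H : bounded_on D (fun x =>
    qpochs_n p (scale (b * (p ^ snd x)%R) nums) (fst x)
    * (qpoch_n (th1 * b) p (snd x + fst x) * qpoch_n (p / (th1 * b)) p (fst x - snd x)
       * (qpoch_n (th2 * b) p (snd x + fst x)
          * qpoch_n (p / (th2 * b)) p (fst x - snd x)))
    * / (qpochs_n p (scale (b * (p ^ snd x)%R) dens) (fst x)
      * (qpoch_n p p (snd x) * qpoch_n (p * b / b') p (snd x)
       * (qpoch_n (b' / b) p (fst x - snd x) * qpoch_n p p (fst x - S (snd x))))))).
  { apply bounded_on_mult.
    - apply bounded_on_mult; [apply Bs|].
      apply bounded_on_mult; apply bounded_on_mult; apply Bq.
    - apply bounded_on_inv. apply away_from_0_mult; [exact nums'|].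
      apply away_from_0_mult; apply away_from_0_mult; apply Aq.
      + apply p_factor_neq_0.
      + apply ratio_factor_neq_0'.
      + apply ratio_factor_neq_0.
      + apply p_factor_neq_0. }
  destruct H as [M [hM H]]. exists M. split; [lra|]. intros n k.
  specialize (H (n, k) I). cbn [fst snd] in H.
  unfold trunc_residue, Cdiv. rewrite <- Cmult_assoc, Cmod_mult, Cmod_pow_p, Rmult_comm
    by exact hp.
  apply Rmult_le_compat_r; [pose proof (pow_p_pos p hp k); lra | exact H].
Qed.

Definition series_term (k : nat) : C :=
  qpochs_n p (scale b dens) k
  / (qpochs_n p (scale b nums) k * (qpoch_n p p k * qpoch_n (p * b / b') p k))
  * (p ^ k)%R.

Definition series_factor : C :=
  qpochs p (scale b nums) * (theta1 (th1 * b) p * theta1 (th2 * b) p)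
  / (qpochs p (scale b dens) * (qpoch (b' / b) p * qpoch p p)).

Lemma residue_limit_eq (k : nat) :
  qpochs_n p (scale b nums) k <> 0 ->
  residue_limit k = series_factor * series_term k.
Proof.
  intros hA. pose proof (dens_shift_neq_0 k) as hz.
  assert (hz' : qpochs_n p (scale b dens) k <> 0).
  { intros E. apply (qpochs_neq_0 b dens haz). rewrite (qpochs_split _ _ k), E. ring. }
  unfold residue_limit, series_factor, series_term.
  rewrite (qpochs_split b nums k), (qpochs_split b dens k).
  pose proof (qpoch_n_neq_0 p p k p_factor_neq_0).
  pose proof (qpoch_n_neq_0 p _ k ratio_factor_neq_0').
  pose proof (qpoch_neq_0 p hp _ ratio_factor_neq_0).
  pose proof (qpoch_neq_0 p hp _ p_factor_neq_0).
  field. repeat split; assumption.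
Qed.

Lemma residue_sum_limit : (forall k, qpochs_n p (scale b nums) k <> 0) ->
  is_Clim (fun n => Csum (map (trunc_residue p nums dens th1 th2 b b' n) (seq 0 n)))
    (series_factor * Cseries series_term).
Proof.
  intros hA. destruct trunc_residue_bound as [M [hM HM]].
  destruct (tannery M p residue_limit
    (fun n k => trunc_residue p nums dens th1 th2 b b' n k)) as [L [H1 H2]];
    auto using is_Clim_trunc_residue.
  assert (hf : forall n, Csum (map residue_limit (seq 0 n))
    = series_factor * Csum (map series_term (seq 0 n))).
  { intros n. rewrite <- Csum_map_scal. f_equal. apply map_ext. intros k.
    now apply residue_limit_eq. }
  replace (series_factor * Cseries series_term) with L; [exact H2|].
  apply (is_Clim_ext _ _ _ hf) in H1.
  destruct (Ceq_dec series_factor 0) as [E|E].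
  - (* a vanishing factor hides the series, whatever its value is *)
    rewrite E, Cmult_0_l. apply (is_Clim_unique _ _ _ H1).
    apply (is_Clim_ext (fun _ => 0)); [intros; rewrite E; ring | apply is_Clim_const].
  - rewrite (Cseries_unique series_term (/ series_factor * L)).
    + field. exact E.
    + apply (is_Clim_ext (fun n => / series_factor
        * (series_factor * Csum (map series_term (seq 0 n))))).
      * intros n. field. exact E.
      * apply is_Clim_mult; [apply is_Clim_const | exact H1].
Qed.

End Pair.
End Residues.

(** The winding number is continuous off the contour, and [b p^k] tends
    to [0]. *)
Lemma inside_0 (p : R) (g : contour) (b : C) : (0 < p < 1)%R ->
  avoids g 0 -> (forall k, inside g (b * (p ^ k)%R)) -> inside g 0.
Proof.
  intros hp h0 hb. split; [exact h0|].
  assert (H : is_cint g (fun z => / (z - 0)) (2 * PI * Ci)).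
  { apply (is_cint_unif_lim g (fun n z => / (z - b * (p ^ n)%R)) _
      (fun _ => 2 * PI * Ci)); [| |apply is_Clim_const].
    - intros n. destruct (hb n) as [ha h1].
      pose proof (is_cint_winding g _ ha) as H. rewrite h1, Cmult_1_r in H. exact H.
    - apply (unif_lim_inv unit_interval (fun n r => g r - b * (p ^ n)%R)
        (fun r => g r - 0)).
      + apply away_from_0_continuous.
        * intros r hr. eapply is_Cderive_continuous.
          now apply is_Cderive_path_minus.
        * intros r hr. now apply Cminus_neq_0, h0.
      + intros e he.
        destruct (pow_lt_eventually (Cmod b) p e (Cmod_ge_0 b) hp he) as [n0 hn].
        exists n0. intros n hn' r _.
        replace (g r - b * (p ^ n)%R - (g r - 0)) with (- (b * (p ^ n)%R)) by ring.
        rewrite Cmod_opp, Cmod_mult, Cmod_pow_p by exact hp. now apply hn. }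
  pose proof (is_cint_winding g 0 h0) as H'.
  apply is_cint_unique in H. apply is_cint_unique in H'.
  unfold winding. rewrite H. field. pose proof two_pi_i_neq_0 as h.
  split; intros E; apply h; rewrite E; ring.
Qed.

Lemma inside_outside_neq (g : contour) (a b : C) : a <> 0 ->
  inside g b -> outside g (/ a) -> 1 - a * b <> 0.
Proof.
  intros ha [_ h1] [_ h0] E.
  assert (Eb : b = / a).
  { transitivity ((1 - (1 - a * b)) / a); [field; exact ha|].
    rewrite E. field. exact ha. }
  rewrite Eb, h0 in h1. injection h1. lra.
Qed.

(** The truncated kernel is rational, so that the residue theorem evaluates its
    integral as [p^n] plus the residues along the two progressions. As [n] tends
    to infinity, the left-hand side converges by uniform convergence on the
    contour and the right-hand side by Tannery's theorem. *)
Theorem kernel_contour_integral (p : R) (nums dens : list C) (th1 th2 b1 b2 : C)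
  (g : contour) :
  (0 < p < 1)%R -> th1 <> 0 -> th2 <> 0 -> b1 <> 0 -> b2 <> 0 ->
  th1 * th2 * b1 * b2 = p ->
  (forall i j, b1 * (p ^ i)%R <> b2 * (p ^ j)%R) ->
  (forall k, qpochs_n p (scale b1 nums) k <> 0) ->
  (forall k, qpochs_n p (scale b2 nums) k <> 0) ->
  (forall a, In a dens -> a <> 0) ->
  avoids g 0 ->
  (forall k, inside g (b1 * (p ^ k)%R)) ->
  (forall k, inside g (b2 * (p ^ k)%R)) ->
  (forall a k, In a dens -> outside g (/ (a * (p ^ k)%R))) ->
  contour_int (fun z => kernel p nums dens th1 th2 b1 b2 z / z) g
  = 2 * PI * Ci
    * (series_factor p nums dens th1 th2 b1 b2 * Cseries (series_term p nums dens b1 b2)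
       + series_factor p nums dens th1 th2 b2 b1 * Cseries (series_term p nums dens b2 b1)).
Proof.
  intros hp h1 h2 hb1 hb2 hbal hne hA1 hA2 ha0 hg0 hin1 hin2 hout.
  pose proof (pow_p_neq_0 p hp) as hpk.
  assert (hne' : forall i j, b2 * (p ^ i)%R <> b1 * (p ^ j)%R)
    by (intros i j E; now apply (hne j i)).
  assert (hbal' : th1 * th2 * b2 * b1 = p) by (rewrite <- hbal; ring).
  assert (haz : forall b, (forall k, inside g (b * (p ^ k)%R)) ->
    forall a, In a dens -> forall k, 1 - a * b * (p ^ k)%R <> 0).
  { intros b hb a ha k.
    replace (1 - a * b * (p ^ k)%R) with (1 - a * (p ^ k)%R * (b * (p ^ 0)%R))
      by (simpl (p ^ 0)%R; ring).
    apply (inside_outside_neq g); auto. now apply Cmult_neq_0; auto. }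
  assert (hpoint : forall w, avoids g w -> away_from_0 unit_interval (fun r => g r - w)).
  { intros w hw. apply away_from_0_continuous.
    - intros r hr. eapply is_Cderive_continuous. now apply is_Cderive_path_minus.
    - intros r hr. now apply avoids_minus_neq_0. }
  assert (hg : bounded_on unit_interval g)
    by (apply bounded_on_continuous; intros; now apply path_Ccontinuous).
  assert (hgi : away_from_0 unit_interval (fun r => / g r))
    by (apply away_from_0_inv; [exact hg | exact hg0]).
  assert (hbz : forall b, (forall k, inside g (b * (p ^ k)%R)) -> forall k,
    away_from_0 unit_interval (fun r => 1 - b / g r * (p ^ k)%R)).
  { intros b hb k.
    apply (away_from_0_ext _ (fun r => (g r - b * (p ^ k)%R) * / g r)).
    - intros r hr. field. now apply hg0.
    - apply away_from_0_mult; [apply hpoint, hb | exact hgi]. }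
  assert (hlim : unif_lim unit_interval
    (fun n r => trunc_kernel p nums dens th1 th2 b1 b2 n (g r) / g r)
    (fun r => kernel p nums dens th1 th2 b1 b2 (g r) / g r)).
  { apply unif_lim_kernel; auto.
    - apply (away_from_0_ext _ (fun r => g r - 0)); [intros; ring|]. now apply hpoint.
    - intros a ha k.
      apply (away_from_0_ext _ (fun r => - (a * (p ^ k)%R) * (g r - / (a * (p ^ k)%R)))).
      + intros r hr. specialize (ha0 a ha). specialize (hpk k). field. auto.
      + apply (away_from_0_mult _ (fun _ => - (a * (p ^ k)%R))).
        * apply away_from_0_const. intros E. apply (Cmult_neq_0 a (p ^ k)%R); auto.
          replace (a * (p ^ k)%R) with (- - (a * (p ^ k)%R)) by ring. rewrite E. ring.
        * now apply hpoint, hout. }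
  apply is_cint_unique. apply (is_cint_unif_lim g
    (fun n z => trunc_kernel p nums dens th1 th2 b1 b2 n z / z) _
    (fun n => 2 * PI * Ci * ((p ^ n)%R
      + (Csum (map (trunc_residue p nums dens th1 th2 b1 b2 n) (seq 0 n))
         + Csum (map (trunc_residue p nums dens th1 th2 b2 b1 n) (seq 0 n)))))).
  - intros n.
    assert (h0w : forall (c : C) k, c <> 0 -> c * (p ^ k)%R <> 0)
      by (intros; now apply Cmult_neq_0).
    assert (hin : forall v, In v (inner_poles p b1 b2 n) -> inside g v).
    { intros v [<-|hv]; [now apply (inside_0 p g b1)|].
      apply in_app_or in hv. destruct hv as [hv|hv]; apply In_qpoints in hv;
        destruct hv as [k [_ ->]]; auto. }
    replace ((p ^ n)%R
      + (Csum (map (trunc_residue p nums dens th1 th2 b1 b2 n) (seq 0 n))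
         + Csum (map (trunc_residue p nums dens th1 th2 b2 b1 n) (seq 0 n))))
      with (Csum (map (simple_residue (regular_part p nums dens th1 th2 n)
        (inner_poles p b1 b2 n)) (inner_poles p b1 b2 n))).
    + apply (is_cint_ext g (fun z => regular_part p nums dens th1 th2 n z
        / Cprod (map (fun v => z - v) (inner_poles p b1 b2 n)))).
      { intros r hr. symmetry. apply trunc_kernel_split; auto. }
      apply residue_theorem_simple with (outer_pole p dens); auto.
      * intros w [a [k [ha ->]]]. now apply hout.
      * now apply rational_regular_part.
      * assert (hd : forall (c : C) b, c <> 0 -> ~ In (RtoC 0) (qpoints p c b)).
        { intros c b hc H. apply In_qpoints in H. destruct H as [k [_ E]].
          now apply (h0w c k hc). }
        constructor.
        -- intros H. apply in_app_or in H. destruct H as [H|H]; now apply hd in H.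
        -- apply NoDup_app; try now apply NoDup_qpoints.
           intros v H1 H2. apply In_qpoints in H1, H2.
           destruct H1 as [i [_ E1]]. destruct H2 as [j [_ E2]].
           apply (hne i j). congruence.
    + unfold inner_poles at 2. cbn [map].
      rewrite Csum_cons, map_app, Csum_app, simple_residue_at_0 by auto.
      f_equal. unfold qpoints. rewrite !map_map.
      f_equal; f_equal; apply map_ext_in; intros k hk; apply in_seq in hk.
      * rewrite <- (simple_residue_at_qpoint p hp nums dens th1 th2 h1 h2 b1 b2)
          by (auto; lia).
        unfold simple_residue, inner_poles. cbn [map].
        rewrite map_app, Cprod_cons, Cprod_app, punctured_neq by auto.
        f_equal. f_equal. ring.
      * rewrite <- (simple_residue_at_qpoint p hp nums dens th1 th2 h1 h2 b2 b1)
          by (auto; lia).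
        unfold simple_residue, inner_poles. cbn [map].
        rewrite map_app, Cprod_cons, Cprod_app, punctured_neq by auto.
        f_equal. rewrite (Cmult_comm (Cprod (map _ (qpoints p b1 n)))).
        f_equal. ring.
  - exact hlim.
  - apply is_Clim_mult; [apply is_Clim_const|].
    replace (series_factor p nums dens th1 th2 b1 b2 * Cseries (series_term p nums dens b1 b2)
       + series_factor p nums dens th1 th2 b2 b1 * Cseries (series_term p nums dens b2 b1))
      with (0 + (series_factor p nums dens th1 th2 b1 b2 * Cseries (series_term p nums dens b1 b2)
       + series_factor p nums dens th1 th2 b2 b1 * Cseries (series_term p nums dens b2 b1)))
      by ring.
    apply is_Clim_plus.
    + apply is_Clim_spec. intros e he.
      destruct (pow_lt_eventually 1 p e) as [n0 hn]; [lra|exact hp|exact he|].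
      exists n0. intros n hn'. specialize (hn n hn').
      replace ((p ^ n)%R - 0) with ((p ^ n)%R : C) by ring.
      rewrite Cmod_pow_p by exact hp. lra.
    + apply is_Clim_plus; apply residue_sum_limit; auto.
Qed.

(** * The overlap coefficient *)

Lemma Cseries_ext (w w' : nat -> C) : (forall n, w n = w' n) -> Cseries w = Cseries w'.
Proof.
  intros E. unfold Cseries, Clim_seq.
  f_equal; f_equal; apply Lim_seq_ext; intros n; f_equal; now apply sum_n_ext.
Qed.

Lemma contour_int_ext (f h : C -> C) (g : contour) :
  (forall z, f z = h z) -> contour_int f g = contour_int h g.
Proof. intros E. apply (RInt_ext (V := C_R_CompleteNormedModule)). intros r _. now rewrite E. Qed.

Lemma theta1_reflect (p : R) (w : C) : p <> 0%R -> w <> 0 ->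
  theta1 (p / w) p = theta1 w p.
Proof.
  intros hp hw. apply RtoC_neq_0 in hp. unfold theta1.
  replace (p / (p / w)) with w by (field; auto). apply Cmult_comm.
Qed.

Lemma qpow_neq_0 (q : R) (w : C) : qpow q w <> 0.
Proof.
  intros E. apply (RtoC_neq_0 1 ltac:(lra)).
  transitivity (qpow q (w + - w)).
  - unfold qpow. replace (ln q * (w + - w)) with (RtoC 0) by ring.
    unfold Cexp, RtoC. simpl. now rewrite exp_0, cos_0, sin_0, Rmult_1_r, Rmult_0_r.
  - rewrite qpow_plus, E. ring.
Qed.

Lemma qpow_opp (q : R) (w : C) : qpow q (- w) = / qpow q w.
Proof.
  pose proof (qpow_neq_0 q w) as h.
  assert (E : qpow q w * qpow q (- w) = 1).
  { rewrite <- qpow_plus. unfold qpow.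
    replace (ln q * (w + - w)) with (RtoC 0) by ring.
    unfold Cexp, RtoC. simpl. now rewrite exp_0, cos_0, sin_0, Rmult_1_r, Rmult_0_r. }
  transitivity (qpow q w * qpow q (- w) / qpow q w); [field; exact h|].
  rewrite E. field. exact h.
Qed.

Lemma Cdiv_neq_0 (a b : C) : a <> 0 -> b <> 0 -> a / b <> 0.
Proof.
  intros ha hb E. apply ha. transitivity (a / b * b); [field; exact hb|].
  rewrite E. ring.
Qed.

Lemma progressions_disjoint (p : R) (b b' : C) : (0 < p < 1)%R ->
  b <> 0 -> b' <> 0 -> (forall k, 1 - b' / b * (p ^ k)%R <> 0) ->
  (forall k, 1 - p * b / b' * (p ^ k)%R <> 0) ->
  forall i j, b * (p ^ i)%R <> b' * (p ^ j)%R.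
Proof.
  intros hp hb hb' h1 h2 i j E. pose proof (pow_p_neq_0 p hp) as hpk.
  destruct (Nat.le_gt_cases i j) as [hij|hij].
  - apply (h1 (j - i)%nat). replace j with (i + (j - i))%nat in E by lia.
    rewrite pow_add, RtoC_mult in E. specialize (hpk i).
    transitivity ((b * (p ^ i)%R - b' * ((p ^ i)%R * (p ^ (j - i))%R)) / (b * (p ^ i)%R));
      [field; auto|]. rewrite <- E. field. auto.
  - apply (h2 (i - S j)%nat). replace i with (j + S (i - S j))%nat in E by lia.
    rewrite pow_add, RtoC_mult in E. specialize (hpk j).
    simpl (p ^ S (i - S j))%R in E. rewrite RtoC_mult in E.
    transitivity ((b' * (p ^ j)%R - b * ((p ^ j)%R * (p * (p ^ (i - S j))%R)))
      / (b' * (p ^ j)%R)); [field; auto|].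
    rewrite E. field. auto.
Qed.

Theorem theorem3p10
  (q s t u v lam eps : R) (x y : C) (g : contour)
  (hq : (0 < q < 1)%R)
  (hs : s <> 0%R) (ht : t <> 0%R) (hu : u <> 0%R) (hv : v <> 0%R)
  (hx : x <> 0) (hy : y <> 0) :
  let al := Params s u t v lam eps in
  let p := (q ^ 2)%R in
  let il := Ci * lam in
  let a := s * qpow q (1 - 2 * il) in
  let b := s * qpow q (1 + 2 * il) in
  let c := RtoC (t * v * q / u) in
  let d := RtoC (q * v / (u * t)) in
  let kappa := qpow q (- (1) - 2 * eps + 2 * il) in
  let bth := t * qpow q (1 + 2 * il) in
  let dth := RtoC (u * q / (v * s)) in
  let at_ := RtoC (s * v * q / u) in
  Phi_admissible q al x y g ->
  qpochs p [p * y / dth; p / y / dth] <> 0 ->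
  psi_defined p at_ y x a b c d ->
  Phi q al x y g =
    qpochs p [bth * y; bth / y] * thetas p [/ kappa; a * d * kappa]
    / qpochs p [RtoC p; p * y / dth; p / y / dth]
    * psi p at_ y x a b c d.
Proof.
  intros al p il a b c d kappa bth dth at_ [hdef hadm] hden [hd1 [hd2 [hd3 hd4]]].
  assert (hp : (0 < p < 1)%R) by (unfold p; simpl; nra).
  pose proof (RtoC_neq_0 p ltac:(lra)) as hp0.
  pose proof (RtoC_neq_0 q ltac:(lra)) as hq0.
  apply RtoC_neq_0 in hs, ht, hu, hv.
  assert (hpq : RtoC p = q * q) by (unfold p; simpl; now rewrite Rmult_1_r, RtoC_mult).
  (* All powers of [q] that occur are monomials in [q], [W] and [Y], so that the
     relations between the parameters become identities of rational functions. *)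
  set (W := qpow q il). set (Y := qpow q (2 * eps)).
  assert (hW : W <> 0) by apply qpow_neq_0.
  assert (hY : Y <> 0) by apply qpow_neq_0.
  assert (hq1 : qpow q 1 = q) by (apply qpow_1; lra).
  assert (Em : qpow q (- il) = / W) by apply qpow_opp.
  assert (E1p : qpow q (1 + il) = q * W) by now rewrite qpow_plus, hq1.
  assert (E1m : qpow q (1 - il) = q / W)
    by (unfold Cminus; now rewrite qpow_plus, hq1, Em).
  assert (E2 : qpow q (2 * il) = W * W)
    by (replace (2 * il) with (il + il) by ring; apply qpow_plus).
  assert (E2p : qpow q (1 + 2 * il) = q * (W * W)) by now rewrite qpow_plus, hq1, E2.
  assert (E2m : qpow q (1 - 2 * il) = q / (W * W))
    by (unfold Cminus; now rewrite qpow_plus, hq1, qpow_opp, E2).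
  assert (Et1 : qpow q (2 * eps - il) = Y / W)
    by (unfold Cminus; now rewrite qpow_plus, Em).
  assert (Et2 : qpow q (- (2 * eps) + il) = W / Y)
    by (rewrite qpow_plus, qpow_opp; fold W Y; field; repeat split; auto).
  assert (Ek : kappa = W * W / (q * Y)).
  { unfold kappa, Cminus. rewrite !qpow_plus, !qpow_opp, hq1, E2. fold Y. field. repeat split; auto. }
  assert (Ea : a = s * q / (W * W)) by (unfold a; rewrite E2m; field; repeat split; auto).
  assert (Eb : b = s * q * (W * W)) by (unfold b; rewrite E2p; ring).
  assert (Ebt : bth = t * q * (W * W)) by (unfold bth; rewrite E2p; ring).
  assert (Rdiv' : forall r r' : R, RtoC r' <> 0 -> RtoC (r / r') = r / r').
  { intros r r' h. apply RtoC_div. intros E. apply h. now rewrite E. }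
  assert (Ec : c = t * v * q / u) by (unfold c; now rewrite Rdiv', !RtoC_mult).
  assert (Ed : d = q * v / (u * t)).
  { unfold d. rewrite Rdiv', !RtoC_mult; [reflexivity|]. rewrite RtoC_mult.
    now apply Cmult_neq_0. }
  assert (Edt : dth = u * q / (v * s)).
  { unfold dth. rewrite Rdiv', !RtoC_mult; [reflexivity|]. rewrite RtoC_mult.
    now apply Cmult_neq_0. }
  assert (Eat : at_ = s * v * q / u) by (unfold at_; now rewrite Rdiv', !RtoC_mult).
  clearbody a b c d kappa bth dth at_.
  (* [b1] and [b2] are the first points of the progressions inside [g]. *)
  set (b1 := s * qpow q (1 - il) / u). set (b2 := t * qpow q (1 + il) / v).
  set (th1 := u * qpow q (2 * eps - il) / s).
  set (th2 := v * qpow q (- (2 * eps) + il) / t).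
  set (nums := [u * s * qpow q (1 + il); t * v * qpow q (1 - il)]).
  set (dens := [u * qpow q (- il) * x; u * qpow q (- il) / x;
              v * qpow q il * y; v * qpow q il / y]).
  assert (Ekernel : forall z,
    Phi_kernel q al x y z / z = kernel p nums dens th1 th2 b1 b2 z / z).
  { intros z. f_equal. unfold Phi_kernel, kernel, thetas, qpochs, Cprod, scale, nums, dens.
    cbn [map fold_right al ps pu pt pv plam peps]. fold p il.
    replace (u * s * z * qpow q (1 + il)) with (u * s * qpow q (1 + il) * z) by ring.
    replace (t * v * z * qpow q (1 - il)) with (t * v * qpow q (1 - il) * z) by ring.
    replace (u * z * qpow q (2 * eps - il) / s) with (th1 * z)
      by (unfold th1, Cdiv; ring).
    replace (v * z * qpow q (- (2 * eps) + il) / t) with (th2 * z)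
      by (unfold th2, Cdiv; ring).
    replace (u * z * qpow q (- il) * x) with (u * qpow q (- il) * x * z) by ring.
    replace (u * z * qpow q (- il) / x) with (u * qpow q (- il) / x * z)
      by (unfold Cdiv; ring).
    replace (v * z * qpow q il * y) with (v * qpow q il * y * z) by ring.
    replace (v * z * qpow q il / y) with (v * qpow q il / y * z)
      by (unfold Cdiv; ring).
    replace (s * qpow q (1 - il) / (u * z)) with (b1 / z)
      by (unfold b1, Cdiv; rewrite Cinv_mult; ring).
    replace (t * qpow q (1 + il) / (v * z)) with (b2 / z)
      by (unfold b2, Cdiv; rewrite Cinv_mult; ring).
    unfold Cdiv. rewrite !Cinv_mult. ring. }
  assert (Eb1 : b1 = s * q / (W * u)) by (unfold b1; rewrite E1m; field; repeat split; auto).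
  assert (Eb2 : b2 = t * q * W / v) by (unfold b2; rewrite E1p; field; repeat split; auto).
  assert (Eth1 : th1 = u * Y / (W * s)) by (unfold th1; rewrite Et1; field; repeat split; auto).
  assert (Eth2 : th2 = v * W / (Y * t)) by (unfold th2; rewrite Et2; field; repeat split; auto).
  assert (hb1 : b1 <> 0) by (rewrite Eb1; apply Cdiv_neq_0; now apply Cmult_neq_0).
  assert (hb2 : b2 <> 0)
    by (rewrite Eb2; apply Cdiv_neq_0; [repeat apply Cmult_neq_0|]; auto).
  assert (hth1 : th1 <> 0) by (rewrite Eth1; apply Cdiv_neq_0; now apply Cmult_neq_0).
  assert (hth2 : th2 <> 0) by (rewrite Eth2; apply Cdiv_neq_0; now apply Cmult_neq_0).
  assert (hk : kappa <> 0) by (rewrite Ek; apply Cdiv_neq_0; now apply Cmult_neq_0).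
  assert (hd0 : d <> 0) by (rewrite Ed; apply Cdiv_neq_0; now apply Cmult_neq_0).
  assert (ha0 : a <> 0)
    by (rewrite Ea; apply Cdiv_neq_0; now apply Cmult_neq_0).
  assert (hadk : a * d * kappa <> 0) by (repeat apply Cmult_neq_0; assumption).
  assert (hbal : th1 * th2 * b1 * b2 = p)
    by (rewrite Eth1, Eth2, Eb1, Eb2, hpq; field; repeat split; auto).
  (* The parameters of the series at [b1] are those of the first 4phi3 of the
     Askey-Wilson function, and those at [b2] belong to the second one. *)
  assert (Lz1 : scale b1 dens = [a * x; a / x; at_ * y; at_ / y]).
  { unfold scale, dens. cbn [map]. rewrite Em, Ea, Eat, Eb1. fold W.
    repeat (apply f_equal2; [field; repeat split; auto|]). reflexivity. }
  assert (Lz2 : scale b2 dens = [p * x / d; p / (d * x); bth * y; bth / y]).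
  { unfold scale, dens. cbn [map]. rewrite Em, Ed, Ebt, Eb2, hpq. fold W.
    repeat (apply f_equal2; [field; repeat split; auto|]). reflexivity. }
  assert (LA1 : scale b1 nums = [a * b; a * c]).
  { unfold scale, nums. cbn [map]. rewrite E1p, E1m, Ea, Eb, Ec, Eb1.
    repeat (apply f_equal2; [field; repeat split; auto|]). reflexivity. }
  assert (LA2 : scale b2 nums = [p * b / d; p * c / d]).
  { unfold scale, nums. cbn [map]. rewrite E1p, E1m, Ed, Eb, Ec, Eb2, hpq.
    repeat (apply f_equal2; [field; repeat split; auto|]). reflexivity. }
  assert (R1 : b2 / b1 = p / (a * d))
    by (rewrite Eb1, Eb2, Ea, Ed, hpq; field; repeat split; auto).
  assert (R1' : p * b1 / b2 = a * d)
    by (rewrite Eb1, Eb2, Ea, Ed, hpq; field; repeat split; auto).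
  assert (R2 : b1 / b2 = a * d / p)
    by (rewrite Eb1, Eb2, Ea, Ed, hpq; field; repeat split; auto).
  assert (R2' : p * b2 / b1 = p ^ 2 / (a * d)).
  { rewrite Eb1, Eb2, Ea, Ed, hpq. field. repeat split; auto. }
  assert (T11 : th1 * b1 = / kappa) by (rewrite Eth1, Eb1, Ek; field; repeat split; auto).
  assert (T21 : th2 * b1 = a * d * kappa)
    by (rewrite Eth2, Eb1, Ea, Ed, Ek; field; repeat split; auto).
  assert (T12 : th1 * b2 = p / (a * d * kappa))
    by (rewrite Eth1, Eb2, Ea, Ed, Ek, hpq; field; repeat split; auto).
  assert (T22 : th2 * b2 = p / (/ kappa))
    by (rewrite Eth2, Eb2, Ek, hpq; field; repeat split; auto).
  assert (Ed1 : p * y / dth = at_ * y) by (rewrite Edt, Eat, hpq; field; repeat split; auto).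
  assert (Ed2 : p / y / dth = at_ / y) by (rewrite Edt, Eat, hpq; field; repeat split; auto).
  assert (ED1 : p * y / (a * d / at_) = bth * y)
    by (rewrite Ea, Ed, Eat, Ebt, hpq; field; repeat split; auto).
  assert (ED2 : p / (y * (a * d / at_)) = bth / y)
    by (rewrite Ea, Ed, Eat, Ebt, hpq; field; repeat split; auto).
  assert (ED3 : p / (a * d / at_ * y) = bth / y)
    by (rewrite <- ED2; f_equal; ring).
  assert (hpk : forall k, RtoC (q ^ (2 * k)) = (p ^ k)%R)
    by (intros k; unfold p; now rewrite pow_mult).
  assert (hpk0 := pow_p_neq_0 p hp).
  assert (hg0 : avoids g 0).
  { destruct hdef as [H [H1 [_ H2]]]. intros r hr. destruct (H2 r hr) as [_ <-].
    apply H1; [lra | exact hr]. }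
  assert (hin1 : forall k, inside g (b1 * (p ^ k)%R)).
  { intros k. destruct (hadm k) as [h _]. cbn [al ps pu pt pv plam] in h. fold il in h.
    rewrite hpk in h. replace (b1 * (p ^ k)%R)
      with (/ u * s * qpow q (1 - il) * (p ^ k)%R) by (unfold b1; field; auto).
    exact h. }
  assert (hin2 : forall k, inside g (b2 * (p ^ k)%R)).
  { intros k. destruct (hadm k) as [_ [h _]]. cbn [al ps pu pt pv plam] in h.
    fold il in h. rewrite hpk in h. replace (b2 * (p ^ k)%R)
      with (/ v * t * qpow q (1 + il) * (p ^ k)%R) by (unfold b2; field; auto).
    exact h. }
  assert (haz0 : forall a', In a' dens -> a' <> 0).
  { intros a' ha. unfold dens in ha. cbn [In] in ha.
    pose proof (qpow_neq_0 q (- il)).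
    destruct ha as [<-|[<-|[<-|[<-|[]]]]];
      [|apply Cdiv_neq_0; [|exact hx] | |apply Cdiv_neq_0; [|exact hy]];
      repeat apply Cmult_neq_0; auto. }
  assert (hout : forall a' k, In a' dens -> outside g (/ (a' * (p ^ k)%R))).
  { intros a' k ha. destruct (hadm k) as [_ [_ [o1 [o2 [o3 o4]]]]].
    cbn [al ps pu pt pv plam] in o1, o2, o3, o4. fold il W in o1, o2, o3, o4.
    rewrite hpk in o1, o2, o3, o4. rewrite Em in o3, o4.
    unfold dens in ha. rewrite Em in ha. fold W in ha. specialize (hpk0 k).
    destruct ha as [<-|[<-|[<-|[<-|[]]]]].
    - replace (/ (u * / W * x * (p ^ k)%R)) with (/ u * W / x / (p ^ k)%R)
        by (field; repeat split; auto). exact o2.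
    - replace (/ (u * / W / x * (p ^ k)%R)) with (/ u * W * x / (p ^ k)%R)
        by (field; repeat split; auto). exact o1.
    - replace (/ (v * W * y * (p ^ k)%R)) with (/ v * / W / y / (p ^ k)%R)
        by (field; repeat split; auto). exact o4.
    - replace (/ (v * W / y * (p ^ k)%R)) with (/ v * / W * y / (p ^ k)%R)
        by (field; repeat split; auto). exact o3. }
  assert (hcons : forall c0 l, Cprod (c0 :: l) <> 0 -> c0 <> 0 /\ Cprod l <> 0).
  { intros c0 l h. split; intros E; apply h; rewrite Cprod_cons, E; ring. }
  cbv zeta in hd3. rewrite ED1, ED2 in hd3.
  unfold qpochs in hden, hd1, hd3. cbn [map] in hden, hd1, hd3.
  rewrite Ed1, Ed2 in hden.
  apply hcons in hden. destruct hden as [n1 hden]. apply hcons in hden.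
  destruct hden as [n2 _].
  apply hcons in hd1. destruct hd1 as [n3 _].
  do 5 (apply hcons in hd3; let h := fresh "m" in destruct hd3 as [h hd3]). 
  assert (hr1 : forall k, 1 - b2 / b1 * (p ^ k)%R <> 0).
  { apply qpoch_n_factor_neq_0. intros n. rewrite R1. now apply qpoch_neq_0_n. }
  assert (hr2 : forall k, 1 - p * b1 / b2 * (p ^ k)%R <> 0).
  { apply qpoch_n_factor_neq_0. intros n. rewrite R1'. specialize (hd2 n).
    do 3 (apply hcons in hd2; let h := fresh "h" in destruct hd2 as [h hd2]). assumption. }
  assert (hA1 : forall k, qpochs_n p (scale b1 nums) k <> 0).
  { intros k. rewrite LA1. specialize (hd2 k). unfold qpochs_n in *. cbn [map] in *.
    apply hcons in hd2. destruct hd2 as [h1 hd2]. apply hcons in hd2.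
    destruct hd2 as [h2 _]. rewrite !Cprod_cons, Cmult_1_r. now apply Cmult_neq_0. }
  assert (hA2 : forall k, qpochs_n p (scale b2 nums) k <> 0).
  { intros k. rewrite LA2. specialize (hd4 k). unfold qpochs_n in *. cbn [map] in *.
    apply hcons in hd4. destruct hd4 as [h1 hd4]. apply hcons in hd4.
    destruct hd4 as [h2 _]. rewrite !Cprod_cons, Cmult_1_r. now apply Cmult_neq_0. }
  assert (hax : forall a', In a' dens -> qpoch (a' * b1) p <> 0).
  { intros a' ha. apply qpoch_neq_0; [exact hp|]. intros k.
    replace (1 - a' * b1 * (p ^ k)%R) with (1 - a' * (p ^ k)%R * (b1 * (p ^ 0)%R))
      by (simpl (p ^ 0)%R; ring).
    apply (inside_outside_neq g); auto. apply Cmult_neq_0; auto. }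
  assert (nax : qpoch (a * x) p <> 0 /\ qpoch (a / x) p <> 0).
  { pose proof (f_equal (fun l : list C => nth 0 l (RtoC 0)) Lz1) as e1.
    pose proof (f_equal (fun l : list C => nth 1 l (RtoC 0)) Lz1) as e2.
    unfold scale, dens in e1, e2. cbn [map nth] in e1, e2. rewrite <- e1, <- e2.
    split; apply hax; unfold dens; cbn [In]; auto. }
  destruct nax as [n4 n5].
  assert (n6 : qpoch p p <> 0) by (apply qpoch_neq_0; [exact hp|]; now apply p_factor_neq_0).
  assert (S1 : Cseries (series_term p nums dens b1 b2)
    = phi43 (a * x) (a / x) (at_ * y) (at_ / y) (a * b) (a * c) (a * d) p p).
  { apply Cseries_ext. intros n. unfold series_term. rewrite Lz1, LA1, R1'.
    unfold qpochs_n, Cprod. cbn [map fold_right]. rewrite (RtoC_pow p n).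
    f_equal. f_equal. ring. }
  assert (S2 : Cseries (series_term p nums dens b2 b1)
    = phi43 (p * x / d) (p / (d * x)) (bth * y) (bth / y)
        (p * b / d) (p * c / d) (p ^ 2 / (a * d)) p p).
  { apply Cseries_ext. intros n. unfold series_term. rewrite Lz2, LA2, R2'.
    unfold qpochs_n, Cprod. cbn [map fold_right]. rewrite (RtoC_pow p n).
    f_equal. f_equal. ring. }
  unfold Phi. rewrite (contour_int_ext _ _ g Ekernel).
  rewrite (kernel_contour_integral p nums dens th1 th2 b1 b2 g)
    by (auto; now apply progressions_disjoint).
  rewrite S1, S2. unfold series_factor.
  rewrite Lz1, Lz2, LA1, LA2, R1, R2, T11, T21, T12, T22.
  (* The thetas at [b2] are the reflections of those at [b1]. *)
  assert (hk' : / kappa <> 0) by (rewrite <- T11; now apply Cmult_neq_0).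
  assert (hp' : p <> 0%R) by lra.
  rewrite (theta1_reflect p (a * d * kappa) hp' hadk), (theta1_reflect p (/ kappa) hp' hk').
  unfold psi, Phi_factor. cbv zeta. cbn [al ps pt plam]. fold il p.
  rewrite ED1, ED2, ED3, Ed1, Ed2, E2m, E2p.
  replace (s * (q / (W * W))) with a by (rewrite Ea; unfold Cdiv; ring).
  replace (t * (q * (W * W))) with bth by (rewrite Ebt; ring).
  replace (p / (d * x)) with (p / (x * d)) by (f_equal; ring).
  unfold thetas, qpochs, Cprod. cbn [map fold_right].
  generalize dependent (phi43 (a * x) (a / x) (at_ * y) (at_ / y) (a * b) (a * c) (a * d) p p).
  generalize dependent (phi43 (p * x / d) (p / (x * d)) (bth * y) (bth / y)
    (p * b / d) (p * c / d) (p ^ 2 / (a * d)) p p).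
  generalize (theta1 (/ kappa) p) (theta1 (a * d * kappa) p).
  pose proof two_pi_i_neq_0 as hpi. revert hpi. generalize (2 * PI * Ci).
  revert n1 n2 n3 n4 n5 n6 m m0 m1 m2 m3. clear.
  repeat match goal with |- context [qpoch ?w p] => generalize (qpoch w p) end.
  intros. field. repeat split; assumption.
Qed.
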